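(* Let $\mathbb K$ be an algebraically closed field of characteristic $0$, let $f(x,y)\in\mathbb K[x,y]$ be monic in $y$, let $\xi$ be a generic element of $\mathbb K$ and $f_\xi=f-\xi$. Then $$\operatorname{I}(f_\xi,f_y)=-\sum_{\sigma}\bigl(e(f_\sigma(\pi))-1\bigr)\lambda_\sigma,$$ where $\sigma$ runs through all split $\pi$-roots of $f_\xi$, and for each such $\sigma$ we write $f_\xi(\sigma)=f_\sigma(\pi)t^{\lambda_\sigma}+(\text{higher order terms in }t)$.
   Context: Put $x=t^{-1}$; for $h\in\mathbb K[x,y]$ write $h(y)$ for $h(t^{-1},y)$, regarded as a polynomial in $y$ over the Puiseux field $\mathbb K\ll t\gg$ (series $\sum a_jt^j$, $a_j\in\mathbb K$, exponents in $\frac1N\mathbb Z$ for some $N$ and bounded below); $\operatorname{ord}$ denotes the smallest exponent of $t$ with nonzero coefficient. For $h_1,h_2\in\mathbb K[x,y]$, the intersection number is $\operatorname{I}(h_1,h_2)=\deg_x\operatorname{Res}_y(h_1,h_2)$. Let $\pi$ be an indeterminate. A $\pi$-root of $h$ is an expression $\sigma=\sum_{j<\delta}a_jt^j+\pi t^{\delta}$ ($a_j\in\mathbb K$, $\delta\in\mathbb Q$) such that $h(\sigma)=h_\sigma(\pi)t^{\lambda}+(\text{higher order terms in }t)$ with $h_\sigma(\pi)\in\mathbb K[\pi]$ of positive degree; $\delta$ is its split order. The $\pi$-root $\sigma$ is split if $h_\sigma(\pi)$ has more than one distinct root. For $p(\pi)\in\mathbb K[\pi]$, $e(p(\pi))$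 denotes the number of distinct roots of $p(\pi)$. *)

(* Defs.v *)
From HB Require Import structures.
From mathcomp Require Import all_boot all_order all_algebra.
From Stdlib Require Import ClassicalEpsilon.
Set Implicit Arguments. Unset Strict Implicit. Unset Printing Implicit Defensive.
Import Order.TTheory GRing.Theory Num.Theory.
Local Open Scope ring_scope.

(* Conventions.
   K[x,y] is represented as {poly {poly K}}: the outer variable is y, the
   coefficients are polynomials in x (as in mathcomp's polyXY).
   K[pi] is {poly K} (the indeterminate 'X plays the role of pi).
   A "generalized t-polynomial" with rational exponents and coefficients in
   K[pi] is represented by a finite list of terms (exponent, coefficient);
   its coefficient at exponent q is the sum of the coefficients of the terms
   with that exponent. *)

Section PiRoots.
Variable K : fieldType.

Definition tterms := seq (rat * {poly K}).

Definition tmul (s1 s2 : tterms) : tterms :=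
  [seq (p.1 + q.1, p.2 * q.2) | p <- s1, q <- s2].

Definition tpow (s : tterms) (n : nat) : tterms := iter n (tmul s) [:: (0, 1)].

Definition tcoef (s : tterms) (q : rat) : {poly K} :=
  \sum_(p <- s | p.1 == q) p.2.

Definition tsupp (s : tterms) : seq rat :=
  [seq q <- undup (map fst s) | tcoef s q != 0].

Definition tord (s : tterms) : rat := head 0 (sort <=%R (tsupp s)).

Definition tlead (s : tterms) : {poly K} := tcoef s (tord s).

(* A pi-expression  sigma = sum_{j<delta} a_j t^j + pi t^delta, stored in
   canonical form: [pr_terms] lists the pairs (j, a_j) with a_j <> 0, in
   strictly increasing order of j, all j < delta.  Canonicity makes equality
   of records coincide with equality of expressions. *)
Definition piexpr : eqType := (seq (rat * K) * rat)%type.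
Definition pr_terms (s : piexpr) : seq (rat * K) := s.1.
Definition pr_delta (s : piexpr) : rat := s.2.

Definition piexpr_wf (s : piexpr) : Prop :=
  [/\ sorted <%R (map fst (pr_terms s)),
      all (fun p => p.2 != 0) (pr_terms s) &
      all (fun p => p.1 < pr_delta s) (pr_terms s)].

Definition piexpr_tterms (s : piexpr) : tterms :=
  rcons [seq (p.1, p.2%:P) | p <- pr_terms s] (pr_delta s, 'X).

(* h(sigma) = sum_{i,j} h_{ij} t^{-i} sigma^j, with x = t^{-1} *)
Definition eval_pi (h : {poly {poly K}}) (s : piexpr) : tterms :=
  flatten [seq flatten [seq tmul [:: (- (i%:R), (h`_j`_i)%:P)]
                                 (tpow (piexpr_tterms s) j)
                       | i <- iota 0 (size h`_j)]
          | j <- iota 0 (size h)].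

Definition h_sigma (h : {poly {poly K}}) (s : piexpr) : {poly K} :=
  tlead (eval_pi h s).
Definition lambda_sigma (h : {poly {poly K}}) (s : piexpr) : rat :=
  tord (eval_pi h s).

Definition is_piroot (h : {poly {poly K}}) (s : piexpr) : Prop :=
  [/\ piexpr_wf s, tsupp (eval_pi h s) != [::] & (1 < size (h_sigma h s))%N].

Definition nroots (p : {poly K}) : nat :=
  size (epsilon (inhabits [::])
          (fun r : seq K => uniq r /\ forall x, root p x = (x \in r))).

Definition is_split_piroot (h : {poly {poly K}}) (s : piexpr) : Prop :=
  is_piroot h s /\ (1 < nroots (h_sigma h s))%N.

Definition inters (h1 h2 : {poly {poly K}}) : nat :=
  (size (resultant h1 h2)).-1.

End PiRoots.

(* Main.v *)
Require Import Defs.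
From HB Require Import structures.
From mathcomp Require Import all_boot all_order all_algebra.
From mathcomp Require Import boolp.
From mathcomp Require Import zify ring lra.
From Stdlib Require Import ClassicalEpsilon.
Set Implicit Arguments. Unset Strict Implicit. Unset Printing Implicit Defensive.
Import Order.TTheory GRing.Theory Num.Theory.
Local Open Scope ring_scope.

(* By Newton-Puiseux, f_xi splits as the product of the y - b over its Puiseux roots b, which
   are distinct for generic xi; hence the resultant of f_xi and f_y is, up to sign, the product
   of the b - c over ordered pairs of distinct roots, and the intersection number is minus the
   sum of the ord (b - c). Setting pi := c in K shows that f_xi(sigma) is the product of the
   sigma - b, so lambda_sigma is the sum over b of the order [meet sigma b] to which sigma and b
   agree, and the roots of f_sigma are the coefficients of t^delta of the roots b that agree
   with sigma below delta. The split pi-roots are therefore the branching nodes of the tree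
   of Puiseux roots. For a fixed root b, inserting the other roots j one by one raises the number
   of branches at exactly one node, the one where j leaves the current tree, and b meets that
   node at order ord (b - j): so the sum over the nodes of (e - 1) * meet is the sum over j
   of ord (b - j). Summing over b gives the formula. *)

(** * Sums of functions with finite support *)

Section FiniteSums.
Variables (K : zmodType) (I : eqType).

Definition supported (l : seq I) (g : I -> K) := forall i, g i != 0 -> i \in l.

(** The list is an arbitrary choice; [sum_supported] makes the value independent of it as soon as
    the support is finite. *)
Definition fsum (g : I -> K) : K :=
  \sum_(i <- epsilon (inhabits [::]) (fun l => uniq l /\ supported l g)) g i.

Lemma sum_supported (l1 l2 : seq I) (g : I -> K) :
  uniq l1 -> uniq l2 -> supported l1 g -> supported l2 g ->
  \sum_(i <- l1) g i = \sum_(i <- l2) g i.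
Proof.
move=> u1 u2 s1 s2.
have E l : \sum_(i <- l) g i = \sum_(i <- [seq i <- l | g i != 0]) g i.
  rewrite big_filter [RHS]big_mkcond /=; apply: eq_bigr => i _.
  by case: eqP => // ->.
rewrite (E l1) (E l2); apply/perm_big/uniq_perm; rewrite ?filter_uniq //.
move=> i; rewrite !mem_filter; case: eqP => //= /eqP gi.
by rewrite (s1 _ gi) (s2 _ gi).
Qed.

Lemma fsumE (l : seq I) (g : I -> K) :
  uniq l -> supported l g -> fsum g = \sum_(i <- l) g i.
Proof.
move=> ul sl; rewrite /fsum; set P := fun _ => _.
have [u s] : P (epsilon (inhabits [::]) P) by apply: epsilon_spec; exists l.
exact: sum_supported.
Qed.

End FiniteSums.

(* [lattice d c] is the set (1/(d+1))Z intersected with [-c, +oo). *)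
Definition lattice (d c : nat) (q : rat) : bool :=
  (q + c%:R) * d.+1%:R \is a Num.nat.

(** A finite list that contains every lattice point up to [B]. For [B < -c] the truncation gives 0
    and the single point [-c] remains. *)
Definition lattice_upto (d c : nat) (B : rat) : seq rat :=
  [seq m%:R / d.+1%:R - c%:R | m <- iota 0 (Num.truncn ((B + c%:R) * d.+1%:R)).+1].

Lemma natS_neq0 (d : nat) : (d.+1%:R : rat) != 0. Proof. by rewrite pnatr_eq0. Qed.
Lemma natS_gt0 (d : nat) : (0 : rat) < d.+1%:R. Proof. by rewrite ltr0n. Qed.
#[local] Hint Resolve natS_neq0 natS_gt0 : core.

Lemma latticeP d c q :
  reflect (exists m : nat, q = m%:R / d.+1%:R - c%:R) (lattice d c q).
Proof.
apply: (iffP natrP) => -[m mE]; exists m.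
  by rewrite -mE mulfK // addrK.
by rewrite mE subrK divfK.
Qed.

Lemma lattice_ge d c q : lattice d c q -> - c%:R <= q.
Proof.
by case/latticeP=> m ->; rewrite lerDr divr_ge0 // ?ler0n.
Qed.

Lemma lattice_upto_uniq d c B : uniq (lattice_upto d c B).
Proof.
rewrite map_inj_uniq ?iota_uniq // => m1 m2 /addIr.
by move/(mulIf (invr_neq0 (natS_neq0 d)))/eqP; rewrite eqr_nat => /eqP.
Qed.

Lemma mem_lattice_upto d c B q :
  lattice d c q -> q <= B -> q \in lattice_upto d c B.
Proof.
case/latticeP=> m -> le; apply/mapP; exists m => //.
rewrite mem_iota /= add0n ltnS.
have h : (m%:R : rat) <= (B + c%:R) * d.+1%:R by rewrite -ler_pdivrMr // -lerBlDr.
by rewrite truncn_ge_nat // (le_trans _ h) ?ler0n.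
Qed.

Lemma mem_lattice_uptoW d c B q : q \in lattice_upto d c B -> lattice d c q.
Proof. by case/mapP=> m _ ->; apply/latticeP; exists m. Qed.

Lemma latticeD d c1 c2 q1 q2 :
  lattice d c1 q1 -> lattice d c2 q2 -> lattice d (c1 + c2) (q1 + q2).
Proof.
rewrite /lattice => h1 h2.
by rewrite natrD addrACA mulrDl rpredD.
Qed.

(** Passage to a common denominator: [d] stands for the denominator [d + 1], so a product of two
    denominators is stored with [.-1]. *)
Lemma lattice_widen d e c c' q : (c <= c')%N ->
  lattice d c q -> lattice (d.+1 * e.+1).-1 c' q.
Proof.
move=> cc'; rewrite /lattice => h.
rewrite prednK ?muln_gt0 // -(subnKC cc') natrD addrA mulrDl natrM mulrA.
apply: rpredD; first by apply: rpredM => //; apply: natr_nat.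
by rewrite -!natrM natr_nat.
Qed.

(** * Puiseux series as coefficient functions, and their additive group *)

Definition pfin (K : zmodType) (d c : nat) (a : rat -> K) :=
  forall q, a q != 0 -> lattice d c q.

Lemma pfin_common (K : zmodType) (a b : rat -> K) :
  (exists d c, pfin d c a) -> (exists d c, pfin d c b) ->
  exists d c, pfin d c a /\ pfin d c b.
Proof.
move=> [d [c h]] [d' [c' h']]; exists (d.+1 * d'.+1).-1, (c + c')%N.
split=> q aq; first by apply: (lattice_widen _ _ (h q aq)); apply: leq_addr.
by rewrite mulnC; apply: (lattice_widen _ _ (h' q aq)); apply: leq_addl.
Qed.

(** Denominator and lower bound are hidden in a proposition, so that two series are equal as soon as
    their coefficient functions are. *)
Record puiseux (K : zmodType) := Puiseux {
  pcoef :> rat -> K;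
  pcoefP : exists d c, pfin d c pcoef }.

Section PuiseuxZmod.
Variable K : zmodType.
Implicit Types a b : puiseux K.

Lemma puiseuxP a b : (a : rat -> K) =1 b <-> a = b.
Proof.
split=> [|-> //]; case: a b => a ha [b hb] /= /funext E; subst b.
by rewrite (Prop_irrelevance ha hb).
Qed.

Lemma pzero_subproof : exists d c, pfin d c (fun _ : rat => 0 : K).
Proof. by exists 0%N, 0%N => q; rewrite eqxx. Qed.
Definition pzero := Puiseux pzero_subproof.

Lemma popp_subproof a : exists d c, pfin d c (fun q => - a q).
Proof. by have [d [c h]] := pcoefP a; exists d, c => q; rewrite oppr_eq0; apply: h. Qed.
Definition popp a := Puiseux (popp_subproof a).

Lemma padd_subproof a b : exists d c, pfin d c (fun q => a q + b q).
Proof.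
have [d [c [ha hb]]] := pfin_common (pcoefP a) (pcoefP b).
exists d, c => q; have [->|/ha //] := eqVneq (a q) 0.
by rewrite add0r; apply: hb.
Qed.
Definition padd a b := Puiseux (padd_subproof a b).

Lemma paddA : associative padd.
Proof. by move=> a b c; apply/puiseuxP => q /=; rewrite addrA. Qed.
Lemma paddC : commutative padd.
Proof. by move=> a b; apply/puiseuxP => q /=; rewrite addrC. Qed.
Lemma padd0 : left_id pzero padd.
Proof. by move=> a; apply/puiseuxP => q /=; rewrite add0r. Qed.
Lemma paddN : left_inverse pzero popp padd.
Proof. by move=> a; apply/puiseuxP => q /=; rewrite addNr. Qed.

(* Opaque, so that simplification does not unfold [==] into [pselect]. *)
Fact puiseux_hasDecEq : hasDecEq (puiseux K). Proof. exact: gen_eqMixin. Qed.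
HB.instance Definition _ := puiseux_hasDecEq.
HB.instance Definition _ := gen_choiceMixin (puiseux K).
HB.instance Definition _ := GRing.isZmodule.Build (puiseux K) paddA paddC padd0 paddN.

Lemma pcoef0 q : (0 : puiseux K) q = 0. Proof. by []. Qed.
Lemma pcoefD a b q : (a + b) q = a q + b q. Proof. by []. Qed.
Lemma pcoefN a q : (- a) q = - a q. Proof. by []. Qed.
Lemma pcoefB a b q : (a - b) q = a q - b q. Proof. by []. Qed.
Lemma pcoef_sum (I : Type) (r : seq I) (P : pred I) (F : I -> puiseux K) q :
  (\sum_(i <- r | P i) F i) q = \sum_(i <- r | P i) F i q.
Proof. by elim/big_rec2: _ => // i x y _ <-. Qed.

End PuiseuxZmod.

(** * Multiplication of Puiseux series *)

Section PuiseuxRing.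
Variable K : comNzRingType.
Implicit Types a b : puiseux K.

Definition conv (f g : rat -> K) (q : rat) : K := fsum (fun r => f r * g (q - r)).

Lemma mulr_neq0_l (x y : K) : x * y != 0 -> x != 0.
Proof. by apply: contraNneq => ->; rewrite mul0r. Qed.
Lemma mulr_neq0_r (x y : K) : x * y != 0 -> y != 0.
Proof. by apply: contraNneq => ->; rewrite mulr0. Qed.

(** The bound on [g] gives [q - r >= - c'], hence [r <= q + c'], while [f] bounds [r] from below:
    finitely many lattice points remain. *)
Lemma conv_supported d c c' (f g : rat -> K) q : pfin d c f -> pfin d c' g ->
  supported (lattice_upto d c (q + c'%:R)) (fun r => f r * g (q - r)).
Proof.
move=> hf hg r nz; apply: mem_lattice_upto; first exact/hf/(mulr_neq0_l nz).
by have := lattice_ge (hg _ (mulr_neq0_r nz)); lra.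
Qed.

Lemma convE d c c' (f g : rat -> K) q : pfin d c f -> pfin d c' g ->
  conv f g q = \sum_(r <- lattice_upto d c (q + c'%:R)) f r * g (q - r).
Proof.
by move=> hf hg; rewrite /conv (fsumE (lattice_upto_uniq _ _ _) (conv_supported hf hg)).
Qed.

Lemma pfin_conv d c c' (f g : rat -> K) : pfin d c f -> pfin d c' g ->
  pfin d (c + c') (conv f g).
Proof.
move=> hf hg q; rewrite (convE _ hf hg) => nz.
have [/hasP[r _ /= nz']|/hasPn h] :=
  boolP (has (fun r => f r * g (q - r) != 0) (lattice_upto d c (q + c'%:R))).
  rewrite -(subrKC r q).
  by apply: latticeD; [apply/hf/(mulr_neq0_l nz') | apply/hg/(mulr_neq0_r nz')].
by case/negP: nz; rewrite big_seq big1 // => r /h; rewrite negbK => /eqP.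
Qed.

Lemma pmul_subproof a b : exists d c, pfin d c (conv a b).
Proof.
have [d [c [ha hb]]] := pfin_common (pcoefP a) (pcoefP b).
by exists d, (c + c)%N; apply: pfin_conv.
Qed.
Definition pmul a b := Puiseux (pmul_subproof a b).

Definition mono (q : rat) (x : K) (r : rat) : K := if r == q then x else 0.

Lemma pmono_subproof q x : exists d c, pfin d c (mono q x).
Proof.
(* A fraction [n/m] in lowest terms lies in [(1/m)Z] and is at least [-|n|]. *)
exists `|denq q|.-1%N, `|numq q|%N => r; rewrite /mono.
case: (r =P q) => [-> _|_]; last by rewrite eqxx.
rewrite /lattice prednK ?absz_gt0 ?denq_neq0 // -[_%:R in X in _ * X]/((`|denq q|%N)%:~R).
rewrite absz_denq mulrDl -{1}(divq_num_den q) divfK ?intr_eq0 ?denq_neq0 //.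
rewrite natr_absz -intrM -intrD natrEint intr_int /= ler0z.
have := denq_gt0 q; nia.
Qed.
Definition pmono q x := Puiseux (pmono_subproof q x).

Lemma pmonoE q x r : pmono q x r = if r == q then x else 0. Proof. by []. Qed.

Lemma pmono_mul q x b r : pmul (pmono q x) b r = x * b (r - q).
Proof.
rewrite /= /conv (@fsumE _ _ [:: q]) //.
  by rewrite big_seq1 /mono eqxx.
by move=> s; rewrite inE /mono; case: (s == q) => //; rewrite mul0r eqxx.
Qed.

Lemma pmulC : commutative pmul.
Proof.
move=> a b; have [d [c [ha hb]]] := pfin_common (pcoefP a) (pcoefP b).
apply/puiseuxP => q /=; rewrite (convE _ hb ha) /conv.
have S := conv_supported (q := q) hb ha.
rewrite (@fsumE _ _ [seq q - r | r <- lattice_upto d c (q + c%:R)]); first last.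
- move=> r nz; apply/mapP; exists (q - r); last by rewrite subKr.
  by apply: S; rewrite subKr mulrC.
- by rewrite map_inj_uniq ?lattice_upto_uniq // => x y /addrI/oppr_inj.
by rewrite big_map; apply: eq_bigr => r _; rewrite subKr mulrC.
Qed.

Lemma pfin_common3 a b (c : puiseux K) :
  exists d e, [/\ pfin d e a, pfin d e b & pfin d e c].
Proof.
have [d [e [ha hb]]] := pfin_common (pcoefP a) (pcoefP b).
have [d' [e' h]] := pcoefP c.
exists ((d.+1 * d'.+1).-1), (e + e')%N; split=> r nz.
- by apply: (lattice_widen _ _ (ha _ nz)); apply: leq_addr.
- by apply: (lattice_widen _ _ (hb _ nz)); apply: leq_addr.
- by rewrite mulnC; apply: (lattice_widen _ _ (h _ nz)); apply: leq_addl.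
Qed.

Lemma pmulDl : left_distributive pmul (@padd K).
Proof.
move=> a1 a2 b; apply/puiseuxP => q /=.
have [d [c [h1 h2 h3]]] := pfin_common3 a1 a2 b.
have h12 : pfin d c (fun q => a1 q + a2 q).
  by move=> r; have [->|/h1 //] := eqVneq (a1 r) 0; rewrite add0r; exact: h2.
rewrite (convE _ h1 h3) (convE _ h2 h3) (convE _ h12 h3) -big_split /=.
by apply: eq_bigr => r _; rewrite mulrDl.
Qed.

Lemma pmul1 : left_id (pmono 0 1) pmul.
Proof. by move=> a; apply/puiseuxP => q; rewrite pmono_mul subr0 mul1r. Qed.

Lemma pmulA : associative pmul.
Proof.
move=> a b c; have [d [e [ha hb hc]]] := pfin_common3 a b c.
have hab := pfin_conv ha hb; have hbc := pfin_conv hb hc.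
apply/puiseuxP => q /=.
rewrite (convE _ ha hbc) (convE _ hab hc).
(* Both sides become one double sum over a box of lattice points containing all nonzero terms; the
   summations are then exchanged. *)
transitivity (\sum_(s <- lattice_upto d e (q + (e + e)%:R))
   \sum_(r <- lattice_upto d (e + e) (q + e%:R)) a s * b (r - s) * c (q - r)).
  rewrite big_seq [RHS]big_seq; apply: eq_bigr => s /mem_lattice_uptoW ls.
  rewrite /conv -(@fsumE _ _ (lattice_upto d (e + e) (q + e%:R))
     (fun r => a s * b (r - s) * c (q - r))) ?lattice_upto_uniq //; last first.
    move=> r nz; apply: mem_lattice_upto.
      rewrite -(subrKC s r); apply: latticeD => //.
      by apply/hb/(mulr_neq0_r (mulr_neq0_l nz)).
    by have := lattice_ge (hc _ (mulr_neq0_r nz)); lra.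
  rewrite (fsumE (lattice_upto_uniq _ _ _) (conv_supported (q := q - s) hb hc)) mulr_sumr.
  set L := lattice_upto _ _ _.
  rewrite (@fsumE K rat [seq r + s | r : rat <- L]).
  - rewrite [RHS]big_map; apply: eq_bigr => r _.
    by rewrite addrK mulrA opprD addrA (addrAC q).
  - by rewrite map_inj_uniq ?lattice_upto_uniq // => x y /addIr.
  move=> r nz; apply/mapP; exists (r - s); last by rewrite subrK.
  apply: (conv_supported (q := q - s) hb hc).
  rewrite opprB addrA subrK.
  by apply: contraNneq nz; rewrite -mulrA => ->; rewrite mulr0.
rewrite exchange_big /= big_seq [RHS]big_seq; apply: eq_bigr => r /mem_lattice_uptoW lr.
rewrite -mulr_suml; have [->|nz] := eqVneq (c (q - r)) 0; first by rewrite !mulr0.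
congr (_ * _); rewrite /conv (@fsumE _ _ (lattice_upto d e (q + (e + e)%:R))) //.
  exact: lattice_upto_uniq.
move=> s nzs; apply: mem_lattice_upto; first exact/ha/(mulr_neq0_l nzs).
have := lattice_ge (hb _ (mulr_neq0_r nzs)).
by have := lattice_ge (hc _ nz); rewrite natrD; lra.
Qed.

Lemma pone_neq0 : pmono 0 1 != 0 :> puiseux K.
Proof.
apply/eqP => /puiseuxP /(_ 0) /=; rewrite /mono eqxx => /eqP.
by rewrite oner_eq0.
Qed.

HB.instance Definition _ :=
  GRing.Zmodule_isComNzRing.Build (puiseux K) pmulA pmulC pmul1 pmulDl pone_neq0.

End PuiseuxRing.

(** * Lower bounds on the order, leading coefficients, and the substitution [x := t^-1] *)

Section Order.
Variable K : comNzRingType.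
Implicit Types a b : puiseux K.

(** Unlike an order, this bound also makes sense for the zero series. *)
Definition pge a (v : rat) := forall q, q < v -> a q = 0.

Lemma pgeW a v w : w <= v -> pge a v -> pge a w.
Proof. by move=> wv h q qw; apply: h; apply: lt_le_trans wv. Qed.

Lemma pgeD a b v : pge a v -> pge b v -> pge (a + b) v.
Proof. by move=> ha hb q qv; rewrite pcoefD ha // hb // addr0. Qed.

Lemma pge_sum (I : Type) (r : seq I) (P : pred I) (F : I -> puiseux K) v :
  (forall i, P i -> pge (F i) v) -> pge (\sum_(i <- r | P i) F i) v.
Proof. by move=> h q qv; rewrite pcoef_sum big1 // => i Pi; apply: h. Qed.

Lemma pcoef_monoM q x b r : (pmono q x * b) r = x * b (r - q).
Proof. exact: pmono_mul. Qed.

Lemma pmonoM q r x y : pmono q x * pmono r y = pmono (q + r) (x * y) :> puiseux K.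
Proof.
apply/puiseuxP => s; rewrite pcoef_monoM !pmonoE subr_eq addrC.
by case: eqP; rewrite ?mulr0.
Qed.

Lemma pmonoX q x n : pmono q x ^+ n = pmono (q *+ n) (x ^+ n) :> puiseux K.
Proof.
elim: n => [|n IH]; first by rewrite !expr0.
by rewrite !exprS IH pmonoM mulrS.
Qed.

Lemma pge_mono q x : pge (pmono q x) q.
Proof. by move=> r; rewrite lt_neqAle pmonoE => /andP[/negPf ->]. Qed.

(** A nonzero term of the convolution has [v <= r] and [w <= q - r]; at [q = v + w] only [r = v]
    survives, and below it nothing does. *)
Lemma pleadM a b v w : pge a v -> pge b w ->
  pge (a * b) (v + w) /\ (a * b) (v + w) = a v * b w.
Proof.
move=> ha hb.
have nz q r : a r * b (q - r) != 0 -> v <= r /\ w <= q - r.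
  move=> nz; split; rewrite leNgt; apply: contraNN nz.
    by move=> /ha ->; rewrite mul0r.
  by move=> /hb ->; rewrite mulr0.
split=> [q qvw|]; rewrite [LHS]/(conv a b _) /conv.
  by rewrite (@fsumE _ _ [::]) ?big_nil // => r /nz; lra.
rewrite (@fsumE _ _ [:: v]) ?big_seq1 1?addrAC ?subrr ?add0r //.
by move=> r /nz h; rewrite inE; apply/eqP; lra.
Qed.

Lemma pge1 : pge 1 0. Proof. exact: pge_mono. Qed.

Lemma plead_prod (I : Type) (s : seq I) (F : I -> puiseux K) (v : I -> rat) :
  (forall i, pge (F i) (v i)) ->
  pge (\prod_(i <- s) F i) (\sum_(i <- s) v i) /\
  (\prod_(i <- s) F i) (\sum_(i <- s) v i) = \prod_(i <- s) F i (v i).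
Proof.
move=> h; elim: s => [|i s [IH1 IH2]].
  by rewrite !big_nil; split; [exact: pge1 | rewrite pmonoE eqxx].
by rewrite !big_cons -IH2; apply: pleadM.
Qed.

Definition pconst (x : K) : puiseux K := pmono 0 x.

Lemma pconst_is_zmod : zmod_morphism pconst.
Proof.
move=> x y; apply/puiseuxP => q.
by rewrite pcoefB !pmonoE; case: eqP; rewrite ?subr0.
Qed.

Lemma pconst_is_monoid : monoid_morphism pconst.
Proof. by split=> // x y; rewrite /pconst pmonoM addr0. Qed.

HB.instance Definition _ := GRing.isZmodMorphism.Build _ _ pconst pconst_is_zmod.
HB.instance Definition _ := GRing.isMonoidMorphism.Build _ _ pconst pconst_is_monoid.

Definition tinv : {poly K} -> puiseux K :=
  horner_morph (fun x => mulrC (pmono (-1) 1) (pconst x)).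
HB.instance Definition _ := GRing.RMorphism.on tinv.

Lemma tinvE p : tinv p = \sum_(i < size p) pmono (- i%:R) p`_i.
Proof.
rewrite /tinv /horner_morph (@horner_coef_wide _ (size p)) ?size_poly //.
apply: eq_bigr => i _; rewrite coef_map pmonoX pmonoM add0r expr1n mulr1.
by rewrite mulNrn.
Qed.

Lemma tinvC x : tinv x%:P = pconst x.
Proof. exact: horner_morphC. Qed.

(** Exponents change sign, so the degree in [x] becomes minus the order in [t]; this is how an
    intersection number is read off a Puiseux series. *)
Lemma plead_tinv p : p != 0 ->
  pge (tinv p) (- (size p).-1%:R) /\ tinv p (- (size p).-1%:R) = lead_coef p.
Proof.
move=> p0; have sp : (0 < size p)%N by rewrite size_poly_gt0.
rewrite tinvE; split.
  apply: pge_sum => i _; apply: pgeW (@pge_mono _ _).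
  by rewrite lerN2 ler_nat -ltnS prednK.
rewrite pcoef_sum lead_coefE.
have lt : ((size p).-1 < size p)%N by rewrite prednK.
rewrite (bigD1 (Ordinal lt)) // pmonoE eqxx big1 => [|i ne]; first exact: addr0.
rewrite pmonoE eqr_opp eqr_nat; case: eqP => // E.
by case/eqP: ne; apply/val_inj.
Qed.

End Order.

(** * The order of a nonzero series, and the integral domain structure *)

Section Domain.
Variable K : idomainType.
Implicit Types a b : puiseux K.

(** The nonzero coefficients sit on a lattice indexed by the natural numbers, so one of them has
    least index. *)
Lemma pord_exists a : a != 0 -> exists v, a v != 0 /\ pge a v.
Proof.
move=> a0; have [d [c h]] := pcoefP a.
have [q aq] : exists q, a q != 0.
  apply: contrapT => /forallNP na; case/eqP: a0; apply/puiseuxP => q.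
  by apply/eqP/negPn/negP/na.
have/latticeP[m0 E0] := h q aq.
have ex : exists m, a (m%:R / d.+1%:R - c%:R) != 0 by exists m0; rewrite -E0.
case: (ex_minnP ex) => m am mmin; exists (m%:R / d.+1%:R - c%:R); split=> // r rlt.
apply/eqP/negPn/negP => ar; have/latticeP[m1 E1] := h r ar.
have := mmin m1; rewrite -E1 => /(_ ar); rewrite leqNgt => /negP; apply.
by move: rlt; rewrite E1 ltrD2r ltr_pM2r ?invr_gt0 // ltr_nat.
Qed.

Definition pord a : rat := epsilon (inhabits 0) (fun v => a v != 0 /\ pge a v).

Lemma pordP a : a != 0 -> a (pord a) != 0 /\ pge a (pord a).
Proof.
move=> /pord_exists; exact: (epsilon_spec (inhabits 0) (fun v => a v != 0 /\ pge a v)).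
Qed.

Lemma pord_uniq a v w : a v != 0 -> pge a v -> a w != 0 -> pge a w -> v = w.
Proof.
move=> av gv aw gw; case: (ltgtP v w) => // h.
  by rewrite gw ?eqxx in av.
by rewrite gv ?eqxx in aw.
Qed.

Lemma pordE a v : a v != 0 -> pge a v -> pord a = v.
Proof.
move=> av gv; have /pordP[h1 h2] : a != 0.
  by apply: contraNneq av => ->.
exact: pord_uniq h1 h2 av gv.
Qed.

(** The integral domain structure asks for a unit predicate and an inverse; both are obtained by
    choice from the existence of an inverse. *)
Definition punit a := `[< exists b, b * a = 1 >].
Definition pinv a := if punit a then epsilon (inhabits 0) (fun b => b * a = 1) else a.

Lemma pmulVr : {in punit, left_inverse 1 pinv *%R}.
Proof.
move=> a ua; rewrite /pinv (ua : punit a = true).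
by move/asboolP: (ua : punit a) => /(epsilon_spec (inhabits 0) (fun b => b * a = 1)).
Qed.

Lemma punitP a b : b * a = 1 -> punit a.
Proof. by move=> h; apply/asboolP; exists b. Qed.

Lemma pinv_out : {in [predC punit], pinv =1 id}.
Proof. by move=> a /negPf ua; rewrite /pinv (ua : punit a = false). Qed.

HB.instance Definition _ :=
  GRing.ComNzRing_hasMulInverse.Build (puiseux K) pmulVr punitP pinv_out.

Lemma puiseux_integral a b : a * b = 0 -> (a == 0) || (b == 0).
Proof.
move=> ab; apply/norP => -[/pordP[na ga] /pordP[nb gb]].
have [_] := pleadM ga gb; rewrite ab pcoef0 => /esym/eqP.
by rewrite mulf_eq0 (negPf na) (negPf nb).
Qed.

HB.instance Definition _ := GRing.ComUnitRing_isIntegral.Build (puiseux K) puiseux_integral.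

End Domain.

(** * Hensel lifting, coefficient by coefficient *)

Section Hensel.
Variable K : fieldType.

Definition cauchy (R : nzRingType) (u v : nat -> R) (m : nat) : R :=
  \sum_(i < m.+1) u i * v (m - i)%N.

(** Multiply a Bezout relation by [r] and reduce the multiplier of [h] modulo [g]. The bound on the
    other multiplier [y] follows by degrees from [g * y = r - x * h]. *)
Lemma bezout_split (g h r : {poly K}) : g \is monic -> h \is monic -> coprimep g h ->
  (size r < size (g * h)%R)%N ->
  exists xy : {poly K} * {poly K}, [/\ (size xy.1 < size g)%N,
    (size xy.2 < size h)%N & g * xy.2 + xy.1 * h = r].
Proof.
move=> mg mh /Bezout_eq1_coprimepP[[u v] /= uv] sr.
have g0 := monic_neq0 mg; have h0 := monic_neq0 mh.
pose x := (r * v) %% g; pose y := r * u + (r * v) %/ g * h.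
have E : g * y + x * h = r.
  rewrite /y mulrDr -addrA [g * (_ * h)]mulrA [g * (_ %/ g)]mulrC -mulrDl -divp_eq.
  by rewrite -[RHS]mulr1 -uv; ring.
have sx : (size x < size g)%N by rewrite ltn_modp.
exists (x, y); split=> //=.
have [->|y0] := eqVneq y 0; first by rewrite size_poly0 size_poly_gt0.
have : (size (g * y)%R < size (g * h)%R)%N.
  rewrite -(addrK (x * h) (g * y)) E (leq_ltn_trans (size_polyD _ _)) //.
  rewrite gtn_max sr size_polyN /=.
  have [->|x0] := eqVneq x 0; first by rewrite mul0r size_poly0 size_poly_gt0 mulf_neq0.
  rewrite !size_mul // -!subn1 ltn_sub2r ?ltn_add2r //.
  by rewrite -addn1 leq_add // size_poly_gt0.
by rewrite !size_mul // -!subn1 ltn_subRL addnC subnK ?ltn_add2l // addn_gt0 size_poly_gt0 g0.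
Qed.

(** [G m] plays the coefficient of [s^m] in a polynomial over [K[[s]]]; [sG] says that only [G 0]
    reaches the top degree, as for a monic polynomial. *)
Variables (G : nat -> {poly K}) (g0 h0 : {poly K}).
Hypotheses (mg : g0 \is monic) (mh : h0 \is monic) (co : coprimep g0 h0).
Hypothesis G0 : G 0%N = g0 * h0.
Hypothesis sG : forall m, (size (G m.+1) < size (G 0%N))%N.

(** The equation compares the coefficients of [s^(m+1)] in the factorization: the two unknown
    corrections are on the left, the products of terms of index 1 to [m] on the right. All earlier
    terms enter, hence the list [s]. *)
Definition hensel_step (m : nat) (s : seq ({poly K} * {poly K})) :=
  epsilon (inhabits (0, 0)) (fun xy : {poly K} * {poly K} =>
    [/\ (size xy.1 < size g0)%N, (size xy.2 < size h0)%N &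
     g0 * xy.2 + xy.1 * h0 =
       G m.+1 - \sum_(i < m) (nth (0, 0) s i.+1).1 * (nth (0, 0) s (m - i)%N).2]).

Fixpoint hensel_seq (m : nat) : seq ({poly K} * {poly K}) :=
  if m is m'.+1 then rcons (hensel_seq m') (hensel_step m' (hensel_seq m'))
  else [:: (g0, h0)].

Definition hensel_term m := nth (0, 0) (hensel_seq m) m.

Lemma size_hensel_seq m : size (hensel_seq m) = m.+1.
Proof. by elim: m => //= m IH; rewrite size_rcons IH. Qed.

Lemma nth_hensel_seq m i : (i <= m)%N -> nth (0, 0) (hensel_seq m) i = hensel_term i.
Proof.
elim: m => [|m IH]; first by rewrite leqn0 => /eqP ->.
rewrite leq_eqVlt => /orP[/eqP -> //|im] /=.
by rewrite nth_rcons size_hensel_seq im IH.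
Qed.

Definition small_term (xy : {poly K} * {poly K}) :=
  (size xy.1 < size g0)%N && (size xy.2 < size h0)%N.

(** The right-hand side stays below the size of [g0 * h0], by [sG] and by the bounds on the earlier
    terms, so [bezout_split] provides a solution for the choice in [hensel_step]. *)
Lemma hensel_termP_aux m : (forall i, (i < m)%N -> small_term (hensel_term i.+1)) ->
  small_term (hensel_term m.+1) /\
  g0 * (hensel_term m.+1).2 + (hensel_term m.+1).1 * h0 =
    G m.+1 - \sum_(i < m) (hensel_term i.+1).1 * (hensel_term (m - i)%N).2.
Proof.
move=> IH.
have E : \sum_(i < m) (nth (0, 0) (hensel_seq m) i.+1).1 *
    (nth (0, 0) (hensel_seq m) (m - i)%N).2 =
  \sum_(i < m) (hensel_term i.+1).1 * (hensel_term (m - i)%N).2.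
  by apply: eq_bigr => i _; rewrite !nth_hensel_seq ?leq_subr.
rewrite [hensel_term m.+1]/hensel_term /= nth_rcons size_hensel_seq ltnn eqxx /hensel_step E.
set P := fun _ => _; suff : P (epsilon (inhabits (0, 0)) P).
  by case=> s1 s2 ->; rewrite /small_term s1 s2.
apply: epsilon_spec.
apply: bezout_split => //; rewrite (leq_ltn_trans (size_polyD _ _)) // gtn_max -G0 sG.
rewrite size_polyN (leq_ltn_trans (size_sum _ _ _)) // G0.
have gh0 : (0 < size (g0 * h0)%R)%N.
  by rewrite size_poly_gt0 mulf_neq0 ?monic_neq0.
rewrite -(prednK gh0) ltnS; apply/bigmax_leqP => j _.
have /andP[s1 _] := IH j (ltn_ord j).
have jk : (m - j = (m - j).-1.+1)%N by rewrite prednK // subn_gt0.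
have /andP[_ s2] : small_term (hensel_term (m - j).-1.+1).
  by apply: IH; rewrite -jk leq_subr.
rewrite -jk in s2; rewrite (leq_trans (size_polyMleq _ _)) //.
rewrite size_mul ?monic_neq0 //; move: s1 s2.
by move: (size _) (size _) (size _) (size _) => *; lia.
Qed.

Lemma hensel_term_small m : small_term (hensel_term m.+1).
Proof.
have [n] := ubnP m; elim: n m => // n IH m; rewrite ltnS => mn.
by apply: (hensel_termP_aux _).1 => i im; apply/IH/(leq_trans im).
Qed.

Lemma hensel_term_prod m :
  G m = cauchy (fun i => (hensel_term i).1) (fun i => (hensel_term i).2) m.
Proof.
case: m => [|m]; first by rewrite /cauchy big_ord1.
have [_ E] := hensel_termP_aux (fun i (_ : (i < m)%N) => hensel_term_small i).
rewrite /cauchy big_ord_recl big_ord_recr /= subn0 subnn /bump /= add1n.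
rewrite -[LHS](subrK (\sum_(i < m)
  (hensel_term i.+1).1 * (hensel_term (m - i)%N).2)) -E.
by rewrite -addrA; congr (_ + _); rewrite addrC.
Qed.

End Hensel.

(** * Power series in [t^(1/(d+1))], and polynomials over them *)

Section PowerSeries.
Variables (K : comNzRingType) (d : nat).

Definition pser_fun (u : nat -> K) (q : rat) : K :=
  if q * d.+1%:R \is a Num.nat then u (Num.truncn (q * d.+1%:R)) else 0.

Lemma pser_pfin u : pfin d 0 (pser_fun u).
Proof.
move=> q; rewrite /pser_fun /lattice addr0.
by case: ifP => //; rewrite eqxx.
Qed.

(* The series [sum_m u_m t^(m/(d+1))]. *)
Definition pser (u : nat -> K) : puiseux K :=
  Puiseux (ex_intro _ d (ex_intro _ 0%N (@pser_pfin u))).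

Lemma pser_funE u m : pser_fun u (m%:R / d.+1%:R) = u m.
Proof. by rewrite /pser_fun divfK // natr_nat natrK. Qed.

Lemma pserE u m : pser u (m%:R / d.+1%:R) = u m.
Proof. exact: pser_funE. Qed.

Lemma pser_out u q : ~~ lattice d 0 q -> pser u q = 0.
Proof. by rewrite /lattice addr0 /= /pser_fun => /negPf ->. Qed.

Lemma pserP a u : pfin d 0 a -> (forall m, a (m%:R / d.+1%:R) = u m) -> a =1 pser u.
Proof.
move=> fa E q; have [/latticeP[m]|nl] := boolP (lattice d 0 q).
  by rewrite subr0 => ->; rewrite E pserE.
by rewrite pser_out //; apply/eqP; apply: contraNT nl; apply: fa.
Qed.

Lemma pserM u v : pser u * pser v = pser (cauchy u v).
Proof.
apply/puiseuxP; apply: pserP.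
  exact: (pfin_conv (@pser_pfin u) (@pser_pfin v)).
move=> m; rewrite [LHS]/(conv _ _ _) /conv.
pose l : seq rat := [seq i%:R / d.+1%:R | i <- iota 0 m.+1].
rewrite (@fsumE _ _ l).
- rewrite big_map -{1}[m.+1]subn0 -/(index_iota 0 m.+1) big_mkord.
  apply: eq_bigr => i _; rewrite -mulrBl -(natrB _ (ltn_ord i : (i <= m)%N)).
  by rewrite !pserE.
- rewrite map_inj_uniq ?iota_uniq // => m1 m2.
  by move/(mulIf (invr_neq0 (natS_neq0 d)))/eqP; rewrite eqr_nat => /eqP.
move=> r nz; have/latticeP[i] := pser_pfin (mulr_neq0_l nz); rewrite subr0 => Er.
apply/mapP; exists i => //; rewrite mem_iota /= add0n ltnS.
have := lattice_ge (pser_pfin (mulr_neq0_r nz)).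
by rewrite oppr0 Er -mulrBl pmulr_lge0 ?invr_gt0 // subr_ge0 ler_nat.
Qed.

Lemma pser0 : pser (fun _ => 0) = 0.
Proof. by apply/puiseuxP => q /=; rewrite /pser_fun if_same. Qed.

Lemma pser1 : pser (fun m => (m == 0)%N%:R) = 1.
Proof.
apply/puiseuxP => q; have [/latticeP[m]|nl] := boolP (lattice d 0 q).
  rewrite subr0 => ->; rewrite pserE pmonoE mulf_eq0 invr_eq0 (negPf (natS_neq0 d)).
  by rewrite orbF pnatr_eq0; case: eqP.
rewrite pser_out // pmonoE; case: eqP nl => // ->.
by rewrite /lattice !add0r mul0r rpred0.
Qed.

Lemma pser_sum (I : Type) (s : seq I) (P : pred I) (F : I -> nat -> K) :
  \sum_(i <- s | P i) pser (F i) = pser (fun m => \sum_(i <- s | P i) F i m).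
Proof.
apply/puiseuxP => q; rewrite pcoef_sum.
have [/latticeP[m]|nl] := boolP (lattice d 0 q).
  by rewrite subr0 => ->; rewrite pserE; apply: eq_bigr => i _; rewrite pserE.
by rewrite pser_out // big1 // => i _; rewrite pser_out.
Qed.

Lemma pserW (c : nat) (a : puiseux K) : pfin d c a -> pge a 0 ->
  a = pser (fun m => a (m%:R / d.+1%:R)).
Proof.
move=> fa ga; apply/puiseuxP; apply: pserP => // q aq.
have q0 : 0 <= q by rewrite leNgt; apply: contraNN aq => /ga ->.
have := fa _ aq; rewrite /lattice addr0 => h.
have -> : q * d.+1%:R = (q + c%:R) * d.+1%:R - (c * d.+1)%:R by rewrite natrM; ring.
rewrite natrEint rpredB ?intr_nat //= ?rpred_nat //.
by rewrite natrM -mulrBl addrK mulr_ge0.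
Qed.

(** Turns an element of [K[y][[s]]], given by its coefficients [P m], into a polynomial in [y] over
    the Puiseux series; [n] is meant to bound all the sizes. *)
Definition psers (n : nat) (P : nat -> {poly K}) : {poly puiseux K} :=
  \poly_(j < n) pser (fun m => (P m)`_j).

Lemma coef_psers n (P : nat -> {poly K}) j : (forall m, (size (P m) <= n)%N) ->
  (psers n P)`_j = pser (fun m => (P m)`_j).
Proof.
move=> sP; rewrite coef_poly; case: ltnP => // nj; rewrite -pser0; congr pser.
by apply/funext => m; rewrite nth_default // (leq_trans (sP m)).
Qed.

Lemma psersM n1 n2 n (P Q : nat -> {poly K}) : (forall m, (size (P m) <= n1)%N) ->
  (forall m, (size (Q m) <= n2)%N) -> (forall m, (size (cauchy P Q m) <= n)%N) ->
  psers n1 P * psers n2 Q = psers n (cauchy P Q).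
Proof.
move=> sP sQ sPQ; apply/polyP => k; rewrite coef_psers // coefM.
under eq_bigr do rewrite !coef_psers // pserM.
rewrite pser_sum; congr pser; apply/funext => m; rewrite /cauchy coef_sum exchange_big /=.
by apply: eq_bigr => i _; rewrite coefM.
Qed.

Lemma psers_monic n (P : nat -> {poly K}) : (size (P 0%N) = n.+1)%N -> P 0%N \is monic ->
  (forall m, (size (P m.+1) < n.+1)%N) ->
  psers n.+1 P \is monic /\ size (psers n.+1 P) = n.+1.
Proof.
move=> s0 m0 sm.
have E : pser (fun m => (P m)`_n) = 1.
  rewrite -pser1; congr pser; apply/funext => -[|m] /=.
    by have := monicP m0; rewrite lead_coefE s0.
  by rewrite nth_default // -ltnS.
have sz : size (psers n.+1 P) = n.+1 by rewrite size_poly_eq //= E oner_neq0.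
by split=> //; rewrite monicE lead_coefE sz coef_poly ltnSn E.
Qed.

End PowerSeries.

Lemma pfin_common_seq (K : zmodType) (f : nat -> puiseux K) (n : nat) :
  exists d c, forall i, (i < n)%N -> pfin d c (f i).
Proof.
elim: n => [|n [d [c h]]]; first by exists 0%N, 0%N.
have [d' [c' h']] := pcoefP (f n).
exists (d.+1 * d'.+1).-1, (c + c')%N => i; rewrite ltnS leq_eqVlt.
case/orP=> [/eqP -> q nz|/h hi q nz].
  by rewrite mulnC; apply: (lattice_widen _ _ (h' _ nz)); apply: leq_addl.
by apply: (lattice_widen _ _ (hi _ nz)); apply: leq_addr.
Qed.

(** * Hensel's lemma over the Puiseux series *)

Section Residue.
Variable K : fieldType.

Definition residue (G : {poly puiseux K}) : {poly K} := \poly_(j < size G) G`_j 0.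

Lemma coef_residue (G : {poly puiseux K}) j : (residue G)`_j = G`_j 0.
Proof. by rewrite coef_poly; case: ltnP => // sG; rewrite nth_default. Qed.

(** The finitely many coefficients share a denominator, so [G] is a power series in some
    [t^(1/(d+1))] with coefficients [Gm] in [K[y]], to which the lifting applies. *)
Lemma hensel (G : {poly puiseux K}) (g h : {poly K}) :
  G \is monic -> (forall j, pge G`_j 0) ->
  g \is monic -> h \is monic -> coprimep g h -> residue G = g * h ->
  exists A B, [/\ A \is monic, size A = size g & G = A * B].
Proof.
move=> mG pG mg mh co rG.
have [d [c hfin]] := pfin_common_seq (fun j => G`_j) (size G).
have fin j : pfin d c G`_j.
  case: (ltnP j (size G)) => [/hfin //|sj q].
  by rewrite nth_default // pcoef0 eqxx.
pose Gm m := \poly_(j < size G) G`_j (m%:R / d.+1%:R).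
have sG : size G = (size G).-1.+1.
  by rewrite prednK // size_poly_gt0 monic_neq0.
have leadG : G`_(size G).-1 = 1 by rewrite -lead_coefE (monicP mG).
have Gm0 : Gm 0%N = g * h by rewrite /Gm mul0r -rG.
have EG : G = psers d (size G) Gm.
  apply/polyP => j; rewrite coef_psers => [|m]; last exact: size_poly.
  rewrite [LHS](pserW (fin j) (pG j)); congr pser; apply/funext => m.
  by rewrite coef_poly; case: ltnP => // sj; rewrite nth_default.
have sGm0 : size (Gm 0%N) = size G.
  rewrite size_poly_eq // leadG mul0r pmonoE eqxx; exact: oner_neq0.
have sGm m : (size (Gm m.+1) < size (Gm 0%N))%N.
  rewrite sGm0 [X in (_ < X)%N]sG ltnS; apply/leq_sizeP => j sj.
  rewrite coef_poly; case: ltnP => // jG.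
  have -> : j = (size G).-1 by apply/eqP; rewrite eqn_leq sj -ltnS -sG jG.
  rewrite leadG pmonoE mulf_eq0 invr_eq0 (negPf (natS_neq0 d)) orbF pnatr_eq0.
  by [].
pose P m := (hensel_term Gm g h m).1; pose Q m := (hensel_term Gm g h m).2.
have small := hensel_term_small mg mh co Gm0 sGm.
have prod := hensel_term_prod mg mh co Gm0 sGm.
have sP m : (size (P m) <= size g)%N.
  by case: m => [|m]; [exact: leqnn | case/andP: (small m) => /ltnW].
have sQ m : (size (Q m) <= size h)%N.
  by case: m => [|m]; [exact: leqnn | case/andP: (small m) => _ /ltnW].
have sg : size g = (size g).-1.+1 by rewrite prednK // size_poly_gt0 monic_neq0.
have [mA sA] : psers d (size g) P \is monic /\ size (psers d (size g) P) = size g.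
  rewrite sg; apply: psers_monic; rewrite -?sg // => m.
  by case/andP: (small m).
exists (psers d (size g) P), (psers d (size h) Q); split=> //.
have E : cauchy P Q = Gm by apply/funext => m; rewrite prod.
rewrite [LHS]EG (@psersM _ _ _ _ (size G)) ?E // => m; exact: size_poly.
Qed.

End Residue.

(** Serves twice: to kill the subleading coefficient by a translation, and to exclude a residue that
    is a pure power of a linear factor. *)
Lemma coef_XaddC_exp (R : comNzRingType) (c : R) n :
  (('X + c%:P) ^+ n)`_n = 1 /\ (('X + c%:P) ^+ n.+1)`_n = c *+ n.+1.
Proof.
elim: n => [|n [IH1 IH2]]; first by rewrite expr0 coef1 expr1 coefD coefX coefC add0r.
have E1 : (('X + c%:P) ^+ n.+1)`_n.+1 = 1.
  rewrite exprSr mulrDr coefD coefMX coefMC /= IH1 nth_default ?mul0r ?addr0 //.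
  by rewrite (leq_trans (size_poly_exp_leq _ _)) // size_XaddC mul1n.
split=> //; rewrite exprSr mulrDr coefD coefMX coefMC /= IH2 E1 mul1r.
by rewrite -mulrSr.
Qed.

(** * The Newton-Puiseux theorem *)

Section NewtonPuiseux.
Variable K : closedFieldType.
Hypothesis charK : [pchar K] =i pred0.
Implicit Types F G : {poly puiseux K}.

Lemma natrK_eq0 n : (n%:R == 0 :> K) = (n == 0)%N.
Proof. by move/pcharf0P: charK => ->. Qed.

Lemma closed_root (p : {poly K}) : (1 < size p)%N -> exists x, root p x.
Proof. by move=> sp; apply/closed_rootP; rewrite neq_ltn sp orbT. Qed.

(** After the rescaling [y = t^q z] all coefficients have order at least 0 and some coefficient
    below the top has nonzero residue. As the subleading one vanishes, the residue is not a power of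
    a linear factor, so it splits into coprime factors and Hensel's lemma gives a factor of smaller
    degree. *)
Lemma depressed_root F n :
  (forall F', F' \is monic -> (1 < size F' < n.+2)%N -> exists r, root F' r) ->
  F \is monic -> size F = n.+2 -> F`_n = 0 -> exists r, root F r.
Proof.
move=> IH mF sF Fn.
have [F0|F0] := eqVneq F`_0 0.
  by exists 0; rewrite /root horner_coef0 F0.
(* Slopes of the Newton polygon; the constant coefficient is nonzero here, so their minimum over
   nonzero coefficients exists. *)
pose slope (j : 'I_n.+1) := pord F`_j / (n.+1 - j)%:R.
have [j0 /= Fj0 slope_min] := @arg_minP _ _ _ ord0 (fun j : 'I_n.+1 => F`_j != 0) slope F0.
set q := slope j0 in slope_min.
pose w j : rat := q * (n.+1 - j)%:R.
(* [G(z)] is [t^(-q(n+1)) F(t^q z)], again monic. *)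
pose G := \poly_(j < n.+2) (pmono (- w j) 1 * F`_j).
have GE j : G`_j = pmono (- w j) 1 * F`_j.
  by rewrite coef_poly; case: ltnP => // jn; rewrite [F`_j]nth_default ?sF ?mulr0.
have GEr j r : G`_j r = F`_j (r + w j) by rewrite GE pcoef_monoM mul1r opprK.
have FN : F`_n.+1 = 1 by have := monicP mF; rewrite lead_coefE sF.
have GN : G`_n.+1 = 1 by rewrite GE FN /w subnn mulr0 oppr0 mulr1.
have sG : size G = n.+2 by rewrite size_poly_eq //= -GE GN oner_neq0.
have mG : G \is monic by rewrite monicE lead_coefE sG GN.
have pG j : pge G`_j 0.
  move=> r r0; rewrite GEr.
  case: (ltngtP j n.+1) => jn; last 1 first.
  - by rewrite jn FN /w subnn mulr0 addr0; apply: pge_mono.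
  - have [->|Fj] := eqVneq F`_j 0; first by [].
    have [_ ge] := pordP Fj; apply: ge; apply: (@lt_le_trans _ _ (w j)); first lra.
    have := slope_min (Ordinal jn) Fj; rewrite /slope /w /= ler_pdivlMr //.
    by rewrite ltr0n subn_gt0.
  - by rewrite nth_default // sF.
have resN : (residue G)`_n = 0 by rewrite coef_residue GE Fn mulr0.
have resj0 : (residue G)`_j0 != 0.
  rewrite coef_residue GEr add0r /w /q /slope divfK; first by case: (pordP Fj0).
  by rewrite pnatr_eq0 -lt0n subn_gt0.
have sR : size (residue G) = n.+2.
  rewrite /residue sG size_poly_eq //= GN pmonoE eqxx; exact: oner_neq0.
have mR : residue G \is monic.
  by rewrite monicE lead_coefE sR coef_residue GN pmonoE eqxx.
have [z0 rz0] : exists z, root (residue G) z by apply: closed_root; rewrite sR.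
have [m [h nrh Eh]] := multiplicity_XsubC (residue G) z0.
rewrite monic_neq0 //= in nrh.
have mh : h \is monic by move: mR; rewrite Eh monicMr // monic_exp ?monicXsubC.
have m0 : (0 < m)%N.
  by case: m Eh => // Eh; move: rz0; rewrite Eh mulr1 (negPf nrh).
have sE : n.+2 = (size h + m)%N.
  rewrite -sR Eh size_Mmonic ?monic_neq0 ?monic_exp ?monicXsubC //.
  by rewrite size_exp_XsubC addnS.
(* For a constant cofactor the residue would be the power [n+1] of ['X - z0]; its subleading
   coefficient [-(n+1) z0] vanishes, so [z0 = 0] in characteristic 0, against the nonzero
   coefficient at [j0]. *)
have sh : (1 < size h)%N.
  rewrite ltnNge; apply/negP => sh; case/negP: resj0.
  have h1 : h = 1.
    by have := monicP mh; rewrite (size1_polyC sh) lead_coefC => ->.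
  rewrite h1 size_poly1 add1n in sE; case: sE => <- {m m0} in Eh *.
  rewrite h1 mul1r in Eh.
  have := (coef_XaddC_exp (- z0) n).2; rewrite polyCN -Eh resN => /esym/eqP.
  rewrite -mulr_natr mulf_eq0 natrK_eq0 orbF oppr_eq0 => /eqP z00.
  by rewrite Eh z00 subr0 coefXn (ltn_eqF (ltn_ord j0)).
have [||A [B [mA sA GAB]]] := hensel mG pG (monic_exp m (monicXsubC z0)) mh.
- by rewrite coprimep_expl // coprimep_sym coprimep_XsubC.
- by rewrite Eh mulrC.
have [|z rz] := IH A mA.
  by rewrite sA size_exp_XsubC ltnS m0 sE -{1}[m.+1]add1n ltn_add2r.
exists (pmono q 1 * z).
have /eqP Gz : root G z by rewrite GAB rootM rz.
have Emon j : (j < n.+2)%N ->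
    pmono (q * n.+1%:R) 1 * pmono (- w j) 1 = pmono q 1 ^+ j :> puiseux K.
  rewrite ltnS => jn; rewrite pmonoX pmonoM expr1n mulr1; congr pmono.
  by rewrite /w natrB // mulr_natr -mulr_natl; ring.
have : pmono (q * n.+1%:R) 1 * G.[z] = F.[pmono q 1 * z].
  rewrite !horner_coef sG sF mulr_sumr; apply: eq_bigr => j _.
  by rewrite GE exprMn -(Emon j) //; ring.
by rewrite Gz mulr0 => /esym/eqP.
Qed.

Lemma pconst_natr_inv n : pconst (n.+1%:R^-1) * n.+1%:R = 1 :> puiseux K.
Proof.
rewrite -(rmorph_nat (@pconst K)) -rmorphM /= mulVf ?rmorph1 //.
by rewrite natrK_eq0.
Qed.

(* The induction removes the subleading coefficient by translation (characteristic 0 is used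
   here), and then factors along the first slope of the Newton polygon by Hensel's lemma. *)
Theorem newton_puiseux F : F \is monic -> (1 < size F)%N -> exists r, root F r.
Proof.
have [n] := ubnP (size F); elim: n F => // n IH F sn mF sF.
case sFE : (size F) sF => [//|[//|m]] _.
pose c := - (pconst (m.+1%:R^-1) * F`_m).
pose q : {poly puiseux K} := 'X + c%:P.
have sq : size q = 2 by rewrite size_XaddC.
have mq : q \is monic by rewrite monicXaddC.
have sFq : size (F \Po q) = m.+2 by rewrite size_comp_poly2.
have FN : F`_m.+1 = 1 by have := monicP mF; rewrite lead_coefE sFE.
have mFq : F \Po q \is monic.
  by rewrite monicE lead_coef_comp ?sq // (monicP mF) (monicP mq) expr1n mulr1.
have Fqm : (F \Po q)`_m = 0.
  rewrite coef_comp_poly sFE !big_ord_recr /= big1 => [|i _]; last first.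
    rewrite [(q ^+ i)`_m]nth_default ?mulr0 //.
    by rewrite (leq_trans (size_poly_exp_leq _ _)) // sq mul1n.
  rewrite add0r FN mul1r; have [-> _] := coef_XaddC_exp c m.
  have [_ ->] := coef_XaddC_exp c m; rewrite mulr1 -[X in _ + X]mulr_natr /c mulNr mulrAC.
  by rewrite pconst_natr_inv mul1r subrr.
have [|r] := depressed_root _ mFq sFq Fqm.
  move=> F' mF' /andP[sF'1 sF'2]; apply: IH => //.
  by rewrite -ltnS (leq_trans _ sn) // ltnS sFE.
by rewrite /root horner_comp; exists q.[r].
Qed.

Corollary puiseux_split F : F \is monic -> exists rs, F = \prod_(r <- rs) ('X - r%:P).
Proof.
have [n] := ubnP (size F); elim: n F => // n IH F sn mF.
have [sF|sF] := leqP (size F) 1.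
  have FC := size1_polyC sF; exists [::].
  by have := monicP mF; rewrite big_nil {1}FC lead_coefC [in X in _ -> X]FC => ->.
have [r /factor_theorem[G E]] := newton_puiseux mF sF.
have mG : G \is monic by move: mF; rewrite E monicMr ?monicXsubC.
have [|rs Ers] := IH G _ mG.
  by move: sn; rewrite E size_Mmonic ?monic_neq0 ?monicXsubC // size_XsubC addn2.
by exists (r :: rs); rewrite big_cons mulrC -Ers.
Qed.

End NewtonPuiseux.

(** * Specialization of [pi], and the leading term of [h(sigma)] *)

Section Specialization.
Variable K : closedFieldType.
Implicit Types (T : tterms K) (s : piexpr K) (b : puiseux K).

Definition teval (c : K) T : puiseux K := \sum_(p <- T) pmono p.1 p.2.[c].

Lemma tevalM c T1 T2 : teval c (tmul T1 T2) = teval c T1 * teval c T2.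
Proof.
rewrite /teval /tmul big_allpairs_dep mulr_suml; apply: eq_bigr => p _.
rewrite mulr_sumr; apply: eq_bigr => q _ /=.
by rewrite hornerM pmonoM.
Qed.

Lemma tevalX c T n : teval c (tpow T n) = teval c T ^+ n.
Proof.
elim: n => [|n IH]; first by rewrite /teval /tpow big_seq1 hornerE.
by rewrite /tpow iterS tevalM IH exprS.
Qed.

Lemma teval_flatten c (Ts : seq (tterms K)) :
  teval c (flatten Ts) = \sum_(T <- Ts) teval c T.
Proof. exact: big_flatten. Qed.

Lemma teval_eval_pi c h s :
  teval c (eval_pi h s) = (map_poly (@tinv K) h).[teval c (piexpr_tterms s)].
Proof.
rewrite /eval_pi teval_flatten big_map (@horner_coef_wide _ (size h)) ?size_poly //.
rewrite -{1}[size h]subn0 -/(index_iota 0 (size h)) big_mkord; apply: eq_bigr => j _.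
rewrite teval_flatten big_map coef_map /= tinvE.
rewrite -{1}[size h`_j]subn0 -/(index_iota 0 (size h`_j)) big_mkord mulr_suml.
apply: eq_bigr => i _; rewrite tevalM tevalX; congr (_ * _).
by rewrite /teval big_seq1 /= hornerC.
Qed.

Lemma coef_teval c T q : teval c T q = (tcoef T q).[c].
Proof.
rewrite /teval pcoef_sum /tcoef horner_sum [RHS]big_mkcond; apply: eq_bigr => p _.
by rewrite pmonoE eq_sym.
Qed.

Lemma poly_eq_closed (p q : {poly K}) : (forall c, p.[c] = q.[c]) -> p = q.
Proof.
move=> E; apply/eqP; rewrite -subr_eq0; apply/negPn/negP => /closed_nonrootP[c].
by rewrite /root !hornerE E subrr eqxx.
Qed.

Lemma mem_tsupp T q : (q \in tsupp T) = (tcoef T q != 0).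
Proof.
rewrite mem_filter mem_undup; case: eqP => //= /eqP nz.
apply: contraNT nz => /mapP nq; rewrite /tcoef big_seq_cond big1 // => p /andP[pT /eqP pq].
by case: nq; exists p.
Qed.

(** The coefficient of [teval c T] at [q] is [tcoef T q] evaluated at [c], and a polynomial over [K]
    is determined by its values, so the leading term can be read on the specializations. *)
Lemma tlead_uniq T mu g : g != 0 ->
  (forall c, pge (teval c T) mu /\ teval c T mu = g.[c]) ->
  [/\ tsupp T != [::], tord T = mu & tlead T = g].
Proof.
move=> g0 h.
have lt_mu q : q < mu -> tcoef T q = 0.
  by move=> qm; apply: poly_eq_closed => c; rewrite -coef_teval (h c).1 // horner0.
have Emu : tcoef T mu = g by apply: poly_eq_closed => c; rewrite -coef_teval (h c).2.
have mum : mu \in tsupp T by rewrite mem_tsupp Emu.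
have ord : tord T = mu.
  rewrite /tord.
  have: sorted <=%R (sort <=%R (tsupp T)) by apply/sort_sorted/le_total.
  have: mu \in sort <=%R (tsupp T) by rewrite mem_sort.
  have: forall q, q \in sort <=%R (tsupp T) -> mu <= q.
    by move=> q; rewrite mem_sort mem_tsupp leNgt; apply: contraNN => /lt_mu ->.
  case: (sort _ _) => // q l mn mul /(order_path_min le_trans)/allP /= ql.
  apply/le_anti; rewrite mn ?mem_head // andbT.
  by move: mul; rewrite inE => /orP[/eqP ->|/ql].
split=> //; first by apply: contraTneq mum => ->.
by rewrite /tlead ord.
Qed.

Definition base s : puiseux K := \sum_(p <- pr_terms s) pmono p.1 p.2.

Lemma teval_piexpr c s : teval c (piexpr_tterms s) = base s + pmono (pr_delta s) c.
Proof.
rewrite /teval /piexpr_tterms -cats1 big_cat big_seq1 big_map /= hornerX.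
by congr (_ + _); apply: eq_bigr => p _; rewrite hornerC.
Qed.

Lemma base_out s q : q \notin map fst (pr_terms s) -> base s q = 0.
Proof.
move=> nq; rewrite /base pcoef_sum big_seq big1 // => p ps.
rewrite pmonoE; case: eqP => // E; case/negP: nq; rewrite E.
exact: map_f.
Qed.

Lemma base_in s p : piexpr_wf s -> p \in pr_terms s -> base s p.1 = p.2.
Proof.
case=> so _ _ ps; have u : uniq (map fst (pr_terms s)).
  exact: (sorted_uniq lt_trans ltxx).
rewrite /base pcoef_sum (bigD1_seq p) ?(map_uniq u) //= {1}/mono eqxx big1_seq ?addr0 //.
move=> p' /andP[ne p's]; rewrite /mono; case: eqP => // E.
case/eqP: ne; move: (p) (p') ps p's E => {p p'} p p'.
elim: (pr_terms s) u => //= x l IH /andP[xl ul]; rewrite !inE.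
case/orP=> [/eqP ->|pl]; case/orP=> [/eqP ->|pl'] // E.
- by case/negP: xl; rewrite E; apply: map_f.
- by case/negP: xl; rewrite -E; apply: map_f.
exact: IH.
Qed.

Lemma base_ge s q : piexpr_wf s -> pr_delta s <= q -> base s q = 0.
Proof.
case=> _ _ /allP lt_d dq; apply: base_out; apply/mapP => -[p ps E].
by have := lt_d p ps; rewrite -E ltNge dq.
Qed.

Lemma mem_base s q : piexpr_wf s -> (q \in map fst (pr_terms s)) = (base s q != 0).
Proof.
move=> wf; apply/idP/idP => [/mapP[p ps ->]|].
  by rewrite base_in //; case: wf => _ /allP/(_ p ps).
by apply: contraR => /base_out ->.
Qed.

(** A canonical list is recovered from [base]: its exponents are the support in increasing order. *)
Lemma piexpr_eq s s' : piexpr_wf s -> piexpr_wf s' ->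
  pr_delta s = pr_delta s' -> base s = base s' -> s = s'.
Proof.
move=> wf wf' Ed Eb.
have E u : piexpr_wf u -> pr_terms u = [seq (q, base u q) | q <- map fst (pr_terms u)].
  move=> wfu; rewrite -map_comp -[LHS]map_id; apply/eq_in_map => p pu /=.
  by rewrite base_in // -surjective_pairing.
have Ef : map fst (pr_terms s) = map fst (pr_terms s').
  apply: lt_sorted_eq; [by case: wf | by case: wf' |].
  by move=> q; rewrite !mem_base // Eb.
have Et : pr_terms s = pr_terms s' by rewrite (E s wf) (E s' wf') Ef Eb.
by case: s s' Ed Et {E wf wf' Eb Ef} => [? ?] [? ?] /= -> ->.
Qed.

Definition agree s b : bool := `[< pge (b - base s) (pr_delta s) >].
Definition meet s b : rat := if agree s b then pr_delta s else pord (b - base s).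
(** The leading coefficient of [sigma - b] in [K[pi]]; [pi] enters only if nothing is left below the
    split order. *)
Definition lead_factor s b : {poly K} :=
  if agree s b then 'X - (b (pr_delta s))%:P else ((base s - b) (meet s b))%:P.

Lemma meet_lt s b : ~~ agree s b -> b - base s != 0 /\ meet s b < pr_delta s.
Proof.
move=> na; rewrite /meet (negPf na); move/asboolP: na => na.
have nz : b - base s != 0 by apply: contra_not_neq na => -> q.
split=> //; rewrite ltNge; apply: contra_notN na => le q qd.
by have [_ ->] := pordP nz; rewrite // (lt_le_trans qd).
Qed.

Lemma meet_le s b : meet s b <= pr_delta s.
Proof.
have [a|/meet_lt[_ /ltW]//] := boolP (agree s b).
by rewrite /meet a.
Qed.

Lemma lead_factor_neq0 s b : lead_factor s b != 0.
Proof.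
rewrite /lead_factor /meet; have [_|na] := boolP (agree s b).
  by rewrite polyXsubC_eq0.
by rewrite polyC_eq0 -(opprB b) pcoefN oppr_eq0; case: (pordP (meet_lt na).1).
Qed.

Lemma plead_factor s b c : piexpr_wf s ->
  pge (teval c (piexpr_tterms s) - b) (meet s b) /\
  (teval c (piexpr_tterms s) - b) (meet s b) = (lead_factor s b).[c].
Proof.
move=> wf; rewrite teval_piexpr.
have E : base s + pmono (pr_delta s) c - b = - (b - base s) + pmono (pr_delta s) c by ring.
split.
  rewrite E; apply: pgeD; last exact: pgeW (meet_le s b) (@pge_mono _ _ _).
  have [a|na] := boolP (agree s b).
    by rewrite /meet a => q qd; rewrite pcoefN (asboolP _ a) ?oppr0.
  rewrite /meet (negPf na) => q qd; rewrite pcoefN.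
  by have [_ ->] := pordP (meet_lt na).1; rewrite ?oppr0.
rewrite /lead_factor; have [a|na] := boolP (agree s b).
  rewrite /meet a !hornerE pcoefB pcoefD pmonoE eqxx base_ge ?add0r //.
rewrite hornerC pcoefB pcoefD pmonoE lt_eqF ?addr0 ?pcoefB //.
exact: (meet_lt na).2.
Qed.

(** Leading terms multiply over the factors [sigma - b], for each value of [pi], and no leading
    factor is the zero polynomial. *)
Lemma lead_split h (B : seq (puiseux K)) s :
  map_poly (@tinv K) h = \prod_(b <- B) ('X - b%:P) -> piexpr_wf s ->
  [/\ tsupp (eval_pi h s) != [::],
      lambda_sigma h s = \sum_(b <- B) meet s b &
      h_sigma h s = \prod_(b <- B) lead_factor s b].
Proof.
move=> hB wf; apply: tlead_uniq.
  by rewrite prodf_seq_neq0; apply/allP => b _; apply: lead_factor_neq0.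
move=> c; rewrite teval_eval_pi hB !horner_prod.
have -> : \prod_(b <- B) ('X - b%:P).[teval c (piexpr_tterms s)] =
    \prod_(b <- B) (teval c (piexpr_tterms s) - b).
  by apply: eq_bigr => b _; rewrite !hornerE.
have [h1 h2] := plead_prod B (fun b => (plead_factor b c wf).1).
by split=> //; rewrite h2; apply: eq_bigr => b _; apply: (plead_factor b c wf).2.
Qed.

(** The distinct roots of [h_sigma], by [root_lead_split]. *)
Definition branches s (B : seq (puiseux K)) : seq K :=
  undup [seq b (pr_delta s) | b <- B & agree s b].

Lemma mem_branches s B x :
  reflect (exists b, [/\ b \in B, agree s b & b (pr_delta s) = x]) (x \in branches s B).
Proof.
rewrite mem_undup; apply: (iffP mapP) => [[b]|[b [bB a <-]]].
  by rewrite mem_filter => /andP[a bB] ->; exists b.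
by exists b; rewrite // mem_filter a.
Qed.

Lemma root_lead_split s B x :
  root (\prod_(b <- B) lead_factor s b) x = (x \in branches s B).
Proof.
rewrite {1}/root horner_prod prodf_seq_eq0; apply/hasP/mem_branches => [[b bB]|[b [bB a <-]]].
  rewrite /= -/(root _ _) /lead_factor; have [a|na] := boolP (agree s b).
    by rewrite root_XsubC => /eqP ->; exists b.
  have := lead_factor_neq0 s b; rewrite /lead_factor (negPf na) polyC_eq0.
  by rewrite rootC => /negPf ->.
by exists b => //=; rewrite -/(root _ _) /lead_factor a root_XsubC eqxx.
Qed.

Lemma nrootsE (p : {poly K}) (l : seq K) :
  uniq l -> (forall x, root p x = (x \in l)) -> nroots p = size l.
Proof.
move=> ul rl; rewrite /nroots; set P := fun _ => _.
have [u r] : P (epsilon (inhabits [::]) P) by apply: epsilon_spec; exists l.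
by apply/perm_size/uniq_perm => // x; rewrite -r rl.
Qed.

Lemma nroots_split h B s :
  map_poly (@tinv K) h = \prod_(b <- B) ('X - b%:P) -> piexpr_wf s ->
  nroots (h_sigma h s) = size (branches s B).
Proof.
move=> hB wf; have [_ _ ->] := lead_split hB wf.
by apply: nrootsE; [apply: undup_uniq | apply: root_lead_split].
Qed.

(** A branch is a root of the nonzero polynomial [h_sigma], which therefore has positive degree; so
    the condition of being a pi-root follows from the branches. *)
Lemma split_pirootP h B s :
  map_poly (@tinv K) h = \prod_(b <- B) ('X - b%:P) ->
  is_split_piroot h s <-> piexpr_wf s /\ (1 < size (branches s B))%N.
Proof.
move=> hB; split=> [[[wf _ _]]|[wf br]]; first by rewrite (nroots_split hB wf).
split; last by rewrite (nroots_split hB wf).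
have [sp _ hs] := lead_split hB wf; split=> //.
case E: (branches s B) br => [//|x l] _.
apply: (@root_size_gt1 _ x).
  rewrite hs prodf_seq_neq0; apply/allP => b _; exact: lead_factor_neq0.
by rewrite hs root_lead_split E mem_head.
Qed.

(** Truncate [b] below [v]: it has finitely many nonzero coefficients there, listed in increasing
    order of exponents. *)
Lemma node_exists b (v : rat) : exists s, [/\ piexpr_wf s, pr_delta s = v & agree s b].
Proof.
have [d [c hb]] := pcoefP b.
pose l := sort <=%R [seq q <- lattice_upto d c v | (q < v) && (b q != 0)].
have ul : uniq l by rewrite sort_uniq filter_uniq // lattice_upto_uniq.
have ml q : (q \in l) = (q < v) && (b q != 0).
  rewrite mem_sort mem_filter; case E: (_ && (b q != 0)) => //=.
  by case/andP: E => qv bq; rewrite mem_lattice_upto ?(ltW qv) // hb.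
exists ([seq (q, b q) | q <- l], v); rewrite /piexpr_wf /pr_terms /pr_delta /=.
split=> //.
- rewrite -map_comp map_id lt_sorted_uniq_le ul; split=> //; first exact/sort_sorted/le_total.
    by apply/allP => p /mapP[q + ->] /=; rewrite ml => /andP[].
  by apply/allP => p /mapP[q + ->] /=; rewrite ml => /andP[].
apply/asboolP => q qv; have {}qv : q < v := qv.
rewrite pcoefB /base pcoef_sum big_map /=.
have [ql|ql] := boolP (q \in l).
  rewrite (bigD1_seq q) //= {1}/mono eqxx big1_seq ?addr0 ?subrr // => r /andP[rq _].
  by rewrite /mono eq_sym (negPf rq).
rewrite big1_seq => [|r /andP[_ rl]].
  by move: ql; rewrite ml qv negbK => /eqP ->; rewrite subr0.
by rewrite /mono; case: eqP => // E; rewrite E rl in ql.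
Qed.

Lemma agree_uniq s s' b : piexpr_wf s -> piexpr_wf s' ->
  pr_delta s = pr_delta s' -> agree s b -> agree s' b -> s = s'.
Proof.
move=> wf wf' Ed /asboolP a /asboolP a'; apply: piexpr_eq => //.
apply/puiseuxP => q; case: (ltP q (pr_delta s)) => qd.
  have h := a q qd; have h' := a' q; rewrite -Ed in h'; have {}h' := h' qd.
  by rewrite pcoefB in h; rewrite pcoefB in h'; rewrite -(subr0_eq h) (subr0_eq h').
by rewrite !base_ge // -Ed.
Qed.

Definition node b (v : rat) : piexpr K :=
  epsilon (inhabits ([::], 0)) (fun s => [/\ piexpr_wf s, pr_delta s = v & agree s b]).

Lemma nodeP b v : [/\ piexpr_wf (node b v), pr_delta (node b v) = v & agree (node b v) b].
Proof. exact: (epsilon_spec _ _ (node_exists b v)). Qed.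

End Specialization.

(** * The tree of Puiseux roots *)

Section Tree.
Variable K : closedFieldType.
Implicit Types (s : piexpr K) (b j k : puiseux K) (B C : seq (puiseux K)).

Lemma pordN b : pord (- b) = pord b.
Proof.
have [->|/pordP[nz ge]] := eqVneq b 0; first by rewrite oppr0.
by apply: pordE; rewrite ?pcoefN ?oppr_eq0 // => q qv; rewrite pcoefN ge ?oppr0.
Qed.

Lemma pord_sym b j : pord (b - j) = pord (j - b).
Proof. by rewrite -pordN opprB. Qed.

Lemma agree_coef s b j q : agree s b -> agree s j -> q < pr_delta s -> b q = j q.
Proof.
move=> /asboolP a /asboolP a' qd; have := a q qd; have := a' q qd.
by rewrite !pcoefB => /subr0_eq -> /subr0_eq.
Qed.

Lemma agree_pord_le s j k : agree s j -> agree s k -> j != k ->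
  pr_delta s <= pord (j - k).
Proof.
move=> aj ak jk; rewrite leNgt; apply/negP => lt.
have [] := @pordP _ (j - k); first by rewrite subr_eq0.
by rewrite pcoefB (agree_coef aj ak lt) subrr eqxx.
Qed.

Lemma agree_pordE s j k : agree s j -> agree s k ->
  j (pr_delta s) != k (pr_delta s) -> pord (j - k) = pr_delta s.
Proof.
move=> aj ak ne; apply: pordE; first by rewrite pcoefB subr_eq0.
by move=> q qd; rewrite pcoefB (agree_coef aj ak qd) subrr.
Qed.

Lemma agree_pord s j k : agree s j -> j != k -> pr_delta s <= pord (j - k) -> agree s k.
Proof.
move=> /asboolP a jk le; apply/asboolP => q qd.
have /pordP[_ /(_ q (lt_le_trans qd le)) E] : j - k != 0 by rewrite subr_eq0.
have := a q qd; move: E; rewrite !pcoefB => /subr0_eq -> //.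
Qed.

(** Below the split order [j] coincides with [base s], so [b - base s] and [b - j] have the same
    terms there; if [b] agrees too, both sides equal the split order. *)
Lemma agree_meet s j b : agree s j -> b != j -> pord (b - j) <= pr_delta s ->
  meet s b = pord (b - j).
Proof.
move=> aj bj le; have [ab|nb] := boolP (agree s b).
  by rewrite /meet ab; apply/le_anti; rewrite le agree_pord_le.
rewrite /meet (negPf nb).
have lt : pord (b - j) < pr_delta s.
  rewrite ltNge; apply: contraNN nb => ge; apply: (agree_pord aj); first by rewrite eq_sym.
  by rewrite pord_sym.
have /pordP[nz ge] : b - j != 0 by rewrite subr_eq0.
have E q : q < pr_delta s -> (b - base s) q = (b - j) q.
  move=> qd; move/asboolP: aj => /(_ q qd); rewrite !pcoefB => /subr0_eq ->.
  by [].
apply: pordE; first by rewrite E.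
by move=> q qv; rewrite E ?ge // (lt_trans qv).
Qed.

Lemma size_branches_perm s B C : B =i C -> size (branches s B) = size (branches s C).
Proof.
move=> BC; apply/perm_size/uniq_perm; rewrite ?undup_uniq // => x.
by apply/mem_branches/mem_branches => -[b [bB a E]]; exists b; rewrite ?BC // -?BC.
Qed.

Lemma size_branches_cons s j C : size (branches s (j :: C)) =
  (size (branches s C) + (agree s j && (j (pr_delta s) \notin branches s C)))%N.
Proof.
rewrite {1}/branches /=; case: ifP => _ /=; last by rewrite addn0.
rewrite mem_undup; case: ifP => _ /=; first by rewrite addn0.
by rewrite addn1.
Qed.

Lemma seq_argmax (T : eqType) (w : T -> rat) (l : seq T) : l != [::] ->
  exists2 x, x \in l & forall x', x' \in l -> w x' <= w x.
Proof.
elim: l => // c [|c' l] IH _; first by exists c; rewrite ?mem_head // => k; rewrite inE => /eqP ->.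
have [k kC kmax] := IH isT.
have [le|lt] := leP (w c) (w k).
  exists k; first by rewrite inE kC orbT.
  by move=> k'; rewrite inE => /orP[/eqP ->|/kmax].
exists c; first exact: mem_head.
by move=> k'; rewrite inE => /orP[/eqP -> //|/kmax/le_trans]; apply; apply: ltW.
Qed.

(* Adding a root [j] to the tree creates one new branch, at the node where [j] leaves
   the tree of the other roots. *)
Lemma branches_step j C : C != [::] -> j \notin C ->
  exists k, [/\ k \in C, (forall k', k' \in C -> pord (j - k') <= pord (j - k)) &
    forall s, piexpr_wf s -> (size (branches s (j :: C)) - 1 =
       size (branches s C) - 1 + (s == node j (pord (j - k)%R)))%N].
Proof.
move=> C0 jC; have [k kC kmax] := seq_argmax (fun k => pord (j - k)) C0.
have jn k' : k' \in C -> j != k' by apply: contraTneq => <-.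
exists k; split=> // s wf.
have [wfn dn an] := nodeP j (pord (j - k)).
(* The subtraction is truncated, so the first branch at a node does not change [size - 1]; hence the
   condition that some root of [C] already passes through [s]. *)
suff -> : (s == node j (pord (j - k))) = (agree s j &&
    (j (pr_delta s) \notin branches s C)) && (0 < size (branches s C))%N.
  by rewrite size_branches_cons; case: (agree s j && _) (size _) => [] [|n] /=; lia.
apply/eqP/andP => [->|[/andP[aj new]]].
  have ak : agree (node j (pord (j - k))) k by apply: (agree_pord an); rewrite ?jn ?dn.
  have kb : k (pr_delta (node j (pord (j - k)))) \in branches (node j (pord (j - k))) C.
    by apply/mem_branches; exists k.
  split; last by case: (branches _ _) kb.
  (* A root [k'] on the branch of [j] at this node would be closer to [j] than [k] is, against the
     maximality of [k]. *)
  rewrite an; apply/mem_branches => -[k' [k'C ak' E]].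
  have := agree_pord_le an ak' (jn _ k'C).
  rewrite dn => le; have Ek : pord (j - k') = pord (j - k).
    by apply/le_anti; rewrite le kmax.
  have /pordP[] : j - k' != 0 by rewrite subr_eq0 jn.
  by rewrite Ek -dn pcoefB E subrr eqxx.
case Eb: (branches s C) => [//|x l] _.
have /mem_branches[k1 [k1C a1 _]] : x \in branches s C by rewrite Eb mem_head.
(* Since [j] opens a new branch at [s], it parts at the split order from every root through [s]. One
   such root exists, so by maximality [k] passes through [s] as well. *)
have lead k' : k' \in C -> agree s k' -> pord (j - k') = pr_delta s.
  move=> k'C ak'; apply: agree_pordE => //; apply: contraNneq new => E.
  by apply/mem_branches; exists k'.
have ak : agree s k.
  by apply: (agree_pord aj); rewrite ?jn // -(lead k1 k1C a1) kmax.
by apply: (agree_uniq wf wfn _ aj an); rewrite dn lead.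
Qed.

(** Induction on [C], one application of [branches_step] per inserted root. [N] stays fixed and
    contains every node created; with [b] alone each node has at most one branch and the sum is
    0. *)
Lemma sum_meet (N : seq (piexpr K)) b C :
  uniq N -> (forall s, s \in N -> piexpr_wf s) -> uniq (b :: C) ->
  (forall j k, j \in b :: C -> k \in b :: C -> j != k -> node j (pord (j - k)) \in N) ->
  \sum_(s <- N) (size (branches s (b :: C)) - 1)%N%:R * meet s b =
  \sum_(j <- C) pord (b - j).
Proof.
move=> uN wfN; elim: C => [|j C IH] u nodes.
  rewrite big_nil big1 // => s _; rewrite size_branches_cons /branches /=.
  by case: (_ && _); rewrite mul0r.
have jbC : j \notin b :: C.
  by move: u; rewrite /= !inE !negb_or (eq_sym b) -!andbA => /and4P[-> _ -> _].
have [k [kC kmax step]] := branches_step (isT : b :: C != [::]) jbC.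
have jb : b != j by apply: contraNneq jbC => <-; apply: mem_head.
have uC : uniq (b :: C) by move: u; rewrite /= !inE negb_or => /andP[/andP[_ ->]] /andP[].
have sub x : x \in b :: C -> x \in b :: j :: C.
  by rewrite !inE => /orP[->|->]; rewrite ?orbT.
have jin : j \in b :: j :: C by rewrite !inE eqxx orbT.
have nN : node j (pord (j - k)) \in N.
  by apply: nodes => //; [exact: sub | apply: contraNneq jbC => ->].
have -> : \sum_(s <- N) (size (branches s (b :: j :: C)) - 1)%N%:R * meet s b =
  \sum_(s <- N) (size (branches s (b :: C)) - 1)%N%:R * meet s b +
  \sum_(s <- N) (s == node j (pord (j - k)))%:R * meet s b.
  rewrite -big_split /= big_seq [RHS]big_seq; apply: eq_bigr => s sN.
  rewrite (@size_branches_perm _ _ (j :: b :: C)) => [|x]; last by rewrite !inE orbCA.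
  by rewrite (step s (wfN s sN)) natrD mulrDl.
rewrite IH // => [|j' k' j'C k'C]; last exact: (nodes _ _ (sub _ j'C) (sub _ k'C)).
rewrite big_cons addrC; congr (_ + _).
rewrite (bigD1_seq _ nN uN) /= eqxx mul1r big1 ?addr0 => [|s /negPf ->]; last by rewrite mul0r.
have [_ dn an] := nodeP j (pord (j - k)).
(* The bound required here is the maximality of [k], since [b] is one of the competing roots. *)
by apply: agree_meet => //; rewrite dn pord_sym kmax // mem_head.
Qed.

Definition nodes_of B : seq (piexpr K) :=
  undup [seq node p.1 (pord (p.1 - p.2)) | p <- [seq (j, k) | j <- B, k <- B] & p.1 != p.2].

Lemma mem_nodes_of B j k : j \in B -> k \in B -> j != k ->
  node j (pord (j - k)) \in nodes_of B.
Proof.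
move=> jB kB jk; rewrite mem_undup; apply/mapP; exists (j, k) => //.
by rewrite mem_filter jk; apply/allpairsP; exists (j, k).
Qed.

(** Two roots with distinct coefficients at the split order part exactly there, so a node with two
    branches comes from a pair; conversely a pair gives two branches at its own node. *)
Lemma nodes_ofP B s :
  s \in nodes_of B <-> piexpr_wf s /\ (1 < size (branches s B))%N.
Proof.
split.
  rewrite mem_undup => /mapP[[j k]]; rewrite mem_filter /= => /andP[jk].
  move=> /allpairsP[[j' k'] [/= jB kB [Ej Ek]]] ->; subst j' k'.
  have [wf dn aj] := nodeP j (pord (j - k)); split=> //.
  set s0 := node _ _ in wf dn aj *.
  have ak : agree s0 k by apply: (agree_pord aj); rewrite ?dn.
  have ne : j (pr_delta s0) != k (pr_delta s0).
    have /pordP[] : j - k != 0 by rewrite subr_eq0.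
    by rewrite -dn pcoefB subr_eq0.
  have : uniq [:: j (pr_delta s0); k (pr_delta s0)] by rewrite /= inE ne.
  move/uniq_leq_size; apply => x; rewrite !inE => /orP[/eqP ->|/eqP ->].
    by apply/mem_branches; exists j.
  by apply/mem_branches; exists k.
move=> [wf]; case E: (branches s B) (undup_uniq [seq b (pr_delta s) | b <- B & agree s b])
  => [|x [|y l]] //; rewrite -/(branches s B) E /= inE negb_or => /andP[/andP[xy _] _] _.
have /mem_branches[j [jB aj Ej]] : x \in branches s B by rewrite E mem_head.
have /mem_branches[k [kB ak Ek]] : y \in branches s B by rewrite E !inE eqxx orbT.
have ne : j (pr_delta s) != k (pr_delta s) by rewrite Ej Ek.
have jk : j != k by apply: contraNneq ne => ->.
have -> : s = node j (pord (j - k)).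
  have [wfn dn an] := nodeP j (pord (j - k)).
  by apply: (agree_uniq wf wfn _ aj an); rewrite dn (agree_pordE aj ak ne).
exact: mem_nodes_of.
Qed.

Lemma tree_sum B : uniq B ->
  \sum_(s <- nodes_of B) (size (branches s B) - 1)%N%:R * (\sum_(b <- B) meet s b) =
  \sum_(b <- B) \sum_(j <- rem b B) pord (b - j).
Proof.
move=> uB; under eq_bigr do rewrite mulr_sumr.
rewrite exchange_big /= big_seq [RHS]big_seq; apply: eq_bigr => b bB.
have pB := perm_to_rem bB.
rewrite -(@sum_meet (nodes_of B)).
- by apply: eq_bigr => s _; rewrite (size_branches_perm s (perm_mem pB)).
- exact: undup_uniq.
- by move=> s /nodes_ofP[].
- by rewrite -(perm_uniq pB).
by move=> j k; rewrite -!(perm_mem pB); apply: mem_nodes_of.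
Qed.

End Tree.

(** * The resultant as a product over roots *)

Section Resultant.
Variable R : idomainType.

(** A Sylvester row holds the coefficients of [X^k p]; against a column of powers of [x] it gives a
    value of that polynomial. *)
Lemma horner_sylvester (p : {poly R}) n k (x : R) : (k + size p <= n)%N ->
  \sum_(l < n) (p`_(l - k) *+ (k <= l)%N) * x ^+ l = x ^+ k * p.[x].
Proof.
move=> le; have <- : ('X^k * p).[x] = x ^+ k * p.[x] by rewrite hornerM hornerXn.
rewrite (@horner_coef_wide _ n).
  by apply: eq_bigr => l _; rewrite coefXnM ltnNge if_neg -mulrb.
by rewrite (leq_trans (size_polyMleq _ _)) // size_polyXn addSn.
Qed.

Lemma horner_prod_XsubC (zs : seq R) x :
  (\prod_(z <- zs) ('X - z%:P)).[x] = \prod_(i < size zs) (x - zs`_i).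
Proof.
rewrite horner_prod (big_nth 0) big_mkord.
by apply: eq_bigr => i _; rewrite !hornerE.
Qed.

Lemma Vandermonde_row_mx m n (w : 'rV[R]_m) (z : 'rV[R]_n) :
  \det (Vandermonde (m + n) (row_mx w z)) = \det (Vandermonde m w) *
    \det (Vandermonde n z) * \prod_(k < m) \prod_(i < n) (z 0 i - w 0 k).
Proof.
rewrite !det_Vandermonde big_split_ord /= mulrAC; congr (_ * _).
  rewrite -big_split /=; apply: eq_bigr => k _; rewrite big_split_ord /=; congr (_ * _).
    by apply: eq_bigr => i _; rewrite !row_mxEl.
  by apply: eq_big => i; rewrite ?ltn_addr // row_mxEl row_mxEr.
apply: eq_bigr => i _; rewrite big_split_ord /= big1 ?mul1r => [|k].
  by apply: eq_big => [k|k _]; rewrite ?ltn_add2l // !row_mxEr.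
by rewrite ltnNge (ltnW (ltn_addr _ (ltn_ord k))).
Qed.

Lemma det_Vandermonde_neq0 n (z : 'rV[R]_n) : injective (z 0) ->
  \det (Vandermonde n z) != 0.
Proof.
move=> inj; rewrite det_Vandermonde; apply/prodf_neq0 => i _; apply/prodf_neq0 => j ij.
by rewrite subr_eq0; apply: contraTneq ij => /inj ->; rewrite ltnn.
Qed.

Lemma fresh_seq (zs : seq R) n : (forall l : seq R, exists x, x \notin l) ->
  exists ws, [/\ size ws = n, uniq ws & forall x, x \in ws -> x \notin zs].
Proof.
move=> inf; elim: n => [|n [ws [sw uw nw]]]; first by exists [::].
have [x] := inf (ws ++ zs); rewrite mem_cat negb_or => /andP[xw xz].
exists (x :: ws); split; rewrite /= ?sw ?xw // => y.
by rewrite inE => /orP[/eqP ->|/nw].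
Qed.

(* Multiplying the Sylvester matrix by the Vandermonde matrix of the roots [zs] of [p] and
   [deg q] further points gives a block triangular matrix. *)
Lemma resultant_prod_XsubC (zs : seq R) (q : {poly R}) :
  (forall l : seq R, exists x, x \notin l) -> uniq zs ->
  exists e : nat, resultant (\prod_(z <- zs) ('X - z%:P)) q =
    (-1) ^+ e * \prod_(z <- zs) q.[z].
Proof.
move=> inf uz; set p := \prod_(z <- zs) _.
have sp : size p = (size zs).+1 by rewrite size_prod_XsubC.
have [ws [sw uw nw]] := fresh_seq zs (size q).-1 inf.
pose dp := (size p).-1; pose dq := (size q).-1.
have dpE : dp = size zs by rewrite /dp sp.
pose w : 'rV[R]_dq := \row_i ws`_i; pose z : 'rV[R]_dp := \row_i zs`_i.
have wi : injective (w 0).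
  move=> i j; rewrite !mxE => /eqP; rewrite nth_uniq ?sw // => /eqP; exact: val_inj.
have zi : injective (z 0).
  move=> i j; rewrite !mxE => /eqP; rewrite nth_uniq -?dpE // => /eqP; exact: val_inj.
have pz i : p.[z 0 i] = 0.
  by apply/rootP; rewrite root_prod_XsubC mxE mem_nth // -dpE.
have pw k : p.[w 0 k] = \prod_(i < dp) (w 0 k - z 0 i).
  rewrite horner_prod_XsubC -dpE; apply: eq_bigr => i _.
  by rewrite [z 0 i]mxE.
pose V := Vandermonde (dq + dp) (row_mx w z).
pose dw := \row_k p.[w 0 k]; pose dz := \row_i q.[z 0 i].
have sum_p (i' : 'I_dq) x : \sum_(l < dq + dp) (p`_(l - i') *+ (i' <= l)%N) * x ^+ l =
    x ^+ i' * p.[x].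
  by apply: horner_sylvester; rewrite /dp sp addnS -addSn leq_add2r.
have sum_q (i' : 'I_dp) x : \sum_(l < dq + dp) (q`_(l - i') *+ (i' <= l)%N) * x ^+ l =
    x ^+ i' * q.[x].
  apply: horner_sylvester; have := ltn_ord i'; rewrite /dq; case: (size q) => [|n]; lia.
(* The upper right block vanishes because the entries of [z] are roots of [p]. *)
have E : Sylvester_mx p q *m V = block_mx (Vandermonde dq w *m diag_mx dw) 0
    (\matrix_(i, k) (w 0 k ^+ i * q.[w 0 k])) (Vandermonde dp z *m diag_mx dz).
  apply/matrixP => i j; rewrite [LHS]mxE.
  under eq_bigr => l _ do rewrite Sylvester_mxE [V l j]mxE.
  rewrite -[i]splitK -[j]splitK; case: (split i) => i'; case: (split j) => j'; rewrite unsplitK /=.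
  - under eq_bigr => l _ do rewrite row_mxEl.
    by rewrite block_mxEul mul_mx_diag [RHS]mxE sum_p !mxE.
  - under eq_bigr => l _ do rewrite row_mxEr.
    by rewrite block_mxEur [RHS]mxE sum_p pz mulr0.
  - under eq_bigr => l _ do rewrite row_mxEl.
    by rewrite block_mxEdl [RHS]mxE sum_q.
  under eq_bigr => l _ do rewrite row_mxEr.
  by rewrite block_mxEdr mul_mx_diag [RHS]mxE sum_q !mxE.
have := congr1 determinant E.
rewrite det_mulmx det_lblock !det_mulmx !det_diag Vandermonde_row_mx -/(resultant p q).
(* The Vandermonde determinant has mixed factors [z - w], the values [p(w)] have factors [w - z];
   this gives the sign. *)
set X := \prod_(k < dq) _; have EX : \prod_(k < dq) dw 0 k = (-1) ^+ (dq * dp) * X.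
  have prod_const n (x : R) : \prod_(i < n) x = x ^+ n by rewrite prodr_const card_ord.
  rewrite mulnC exprM -prod_const -big_split; apply: eq_bigr => k _ /=.
  rewrite mxE pw -prod_const -big_split; apply: eq_bigr => i _ /=.
  by rewrite mulN1r opprB.
rewrite EX.
have EZ : \prod_(i < dp) dz 0 i = \prod_(z <- zs) q.[z].
  by rewrite (big_nth 0) big_mkord -dpE; apply: eq_bigr => i _; rewrite !mxE.
rewrite EZ => H; exists (dq * dp)%N.
(* The auxiliary points avoid the roots, so the mixed product can be cancelled. *)
have X0 : X != 0.
  apply/prodf_neq0 => k _; apply/prodf_neq0 => i _; rewrite subr_eq0 !mxE.
  have : ws`_k \notin zs by apply/nw/mem_nth; rewrite sw.
  by apply: contraNneq => <-; apply: mem_nth; rewrite -dpE.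
have D0 : \det (Vandermonde dq w) * \det (Vandermonde dp z) * X != 0.
  by rewrite !mulf_neq0 ?det_Vandermonde_neq0.
by apply: (mulIf D0); rewrite H; ring.
Qed.
End Resultant.

Lemma resultant_small (R : comNzRingType) (p q : {poly R}) :
  (size p <= 1)%N -> (size q <= 1)%N -> resultant p q = 1.
Proof.
move=> sp sq; rewrite /resultant; move: (Sylvester_mx p q).
have -> : ((size q).-1 + (size p).-1 = 0)%N by move: sp sq; case: (size p) (size q) => [|[|//]] [|[|//]].
by move=> M; rewrite det_mx00.
Qed.

(** * Intersection number and generic choice of [xi] *)

Section Main.
Variable K : closedFieldType.
Hypothesis charK : [pchar K] =i pred0.

(** Some constant of [K] differs from the coefficient of [t^0] of every member of [l]. *)
Lemma puiseux_infinite (l : seq (puiseux K)) : exists x, x \notin l.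
Proof.
have : \prod_(b <- l) ('X - (b 0)%:P) != 0 :> {poly K}.
  by rewrite monic_neq0 // monic_prod_XsubC.
move=> /closed_nonrootP[c nr]; exists (pconst c); apply: contraNN nr => cl.
rewrite /root horner_prod prodf_seq_eq0; apply/hasP; exists (pconst c) => //=.
by rewrite !hornerE /mono eqxx subrr.
Qed.

Lemma tinv_eq0 (p : {poly K}) : (tinv p == 0) = (p == 0).
Proof.
apply/eqP/eqP => [E|->]; last exact: rmorph0.
apply/eqP/negPn/negP => p0; have [_] := plead_tinv p0.
by rewrite E pcoef0 => /esym/eqP; rewrite lead_coef_eq0 (negPf p0).
Qed.

Lemma pord_tinv (p : {poly K}) : p != 0 -> pord (tinv p) = - (size p).-1%:R.
Proof.
by move=> p0; have [ge E] := plead_tinv p0; apply: pordE => //; rewrite E lead_coef_eq0.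
Qed.

Lemma pord_prod (I : eqType) (s : seq I) (F : I -> puiseux K) :
  (forall i, i \in s -> F i != 0) ->
  \prod_(i <- s) F i != 0 /\ pord (\prod_(i <- s) F i) = \sum_(i <- s) pord (F i).
Proof.
elim: s => [|i s IH] nz.
  rewrite !big_nil oner_neq0; split=> //; apply: pordE; last exact: pge1.
  by rewrite pmonoE eqxx oner_neq0.
have [|nzs Es] := IH; first by move=> j js; apply: nz; rewrite inE js orbT.
have nzi := nz i (mem_head _ _).
rewrite !big_cons mulf_neq0 //; split=> //; rewrite -Es.
have [n1 g1] := pordP nzi; have [n2 g2] := pordP nzs.
by have [g E] := pleadM g1 g2; apply: pordE => //; rewrite E mulf_neq0.
Qed.

Lemma pord_signM (b : puiseux K) e : pord ((-1) ^+ e * b) = pord b.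
Proof. by rewrite -signr_odd; case: (odd e); rewrite ?mulN1r ?pordN ?mul1r. Qed.

Lemma deriv_prod_XsubC (B : seq (puiseux K)) b : b \in B ->
  (\prod_(c <- B) ('X - c%:P))^`().[b] = \prod_(c <- rem b B) (b - c).
Proof.
move=> bB; rewrite (perm_big _ (perm_to_rem bB)) big_cons derivM derivXsubC mul1r.
rewrite !hornerE subrr mul0r addr0 horner_prod.
by apply: eq_bigr => c _; rewrite !hornerE.
Qed.

Lemma uniq_rem (T : eqType) (B : seq T) : (forall b, b \in B -> b \notin rem b B) -> uniq B.
Proof.
elim: B => //= b B IH h; have := h b (mem_head _ _); rewrite eqxx => bB.
rewrite bB IH // => c cB; have := h c; rewrite inE cB orbT => /(_ isT).
have [E|_] := eqVneq b c; first by rewrite -E (negPf bB) in cB.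
by rewrite inE negb_or => /andP[].
Qed.

(** Under [x := t^-1] the degree of the resultant becomes minus its order, and the resultant is up
    to sign the product of the [g(b)], each of which is the product of [b - c] over the other roots.
    Their being nonzero also excludes multiple roots. *)
Lemma inters_simple_roots (h g : {poly {poly K}}) (B : seq (puiseux K)) :
  map_poly (@tinv K) h = \prod_(b <- B) ('X - b%:P) -> g = h^`() -> g != 0 ->
  (forall b, b \in B -> (map_poly (@tinv K) g).[b] != 0) ->
  uniq B /\ (inters h g)%:R = - \sum_(b <- B) \sum_(c <- rem b B) pord (b - c) :> rat.
Proof.
move=> hB gE g0 nz.
have dE b : b \in B -> (map_poly (@tinv K) g).[b] = \prod_(c <- rem b B) (b - c).
  by move=> bB; rewrite gE -deriv_map hB deriv_prod_XsubC.
have nzc b : b \in B -> forall c, c \in rem b B -> b - c != 0.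
  move=> bB c cB; have := nz b bB; rewrite dE // prodf_seq_neq0 => /allP/(_ c cB).
  by [].
have uB : uniq B.
  by apply: uniq_rem => b bB; apply/negP => /(nzc b bB); rewrite subrr eqxx.
split=> //.
have h0 : h != 0.
  apply: contraNneq g0 => h0; by rewrite gE h0 deriv0.
have [e Ee] := resultant_prod_XsubC (map_poly (@tinv K) g) puiseux_infinite uB.
have Er : tinv (resultant h g) = (-1) ^+ e * \prod_(b <- B) (map_poly (@tinv K) g).[b].
  by rewrite -Ee -hB map_resultant // tinv_eq0 lead_coef_eq0.
have [nzp Ep] := pord_prod nz.
have r0 : resultant h g != 0.
  by rewrite -tinv_eq0 Er mulf_neq0 // signr_eq0.
rewrite /inters -[LHS]opprK -pord_tinv // Er pord_signM Ep.
congr (- _); rewrite big_seq [RHS]big_seq; apply: eq_bigr => b bB.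
by rewrite dE // (pord_prod (nzc b bB)).2.
Qed.

(** Here [h(sigma)] does not involve [pi], so a root of [h_sigma] would make it zero. *)
Lemma const_no_split (h : {poly {poly K}}) s : (size h <= 1)%N -> ~ is_split_piroot h s.
Proof.
move=> sh [[wf supp sz] br].
have E x y : teval x (eval_pi h s) = teval y (eval_pi h s).
  by rewrite !teval_eval_pi (size1_polyC sh) map_polyC !hornerC.
have [x rx] := closed_root sz.
have : h_sigma h s = 0.
  apply: poly_eq_closed => y; rewrite horner0 -(rootP rx) /h_sigma /tlead -!coef_teval.
  by rewrite (E x y).
by move=> h0; rewrite h0 size_poly0 in sz.
Qed.

End Main.

Theorem theorem3p4 (K : closedFieldType) (hchar : [pchar K] =i pred0)
    (f : {poly {poly K}}) (hmonic : f \is monic) :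
  exists bad : seq K, forall xi : K, xi \notin bad ->
    let fxi := f - (xi%:P)%:P in
    exists S : seq (piexpr K),
      [/\ uniq S,
          (forall s, s \in S <-> is_split_piroot fxi s) &
          ((inters fxi f^`())%:R : rat) =
            - \sum_(s <- S)
                ((nroots (h_sigma fxi s) - 1)%N%:R * lambda_sigma fxi s)].
Proof.
have dfxi xi : f^`() = (f - (xi%:P)%:P)^`() by rewrite derivB derivC subr0.
have [sf|sf] := leqP (size f) 1.
  (* Here [f] is 1, and both sides of the formula are 0 for every [xi]. *)
  exists [::] => xi _ /=; exists [::].
  have sfxi : (size (f - (xi%:P)%:P)%R <= 1)%N.
    by rewrite (leq_trans (size_polyD _ _)) // geq_max sf size_polyN size_polyC_leq1.
  split=> //; first by move=> s; split=> // /(const_no_split sfxi).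
  rewrite big_nil oppr0 /inters resultant_small ?size_poly1 //.
  by rewrite (size1_polyC sf) derivC size_poly0.
pose F := map_poly (@tinv K) f.
have mF : F \is monic by apply: monic_map.
have sF : size F = size f.
  by rewrite size_map_poly_id0 // (monicP hmonic) rmorph1 oner_neq0.
pose N := (size f).-2.
have sN : size f = N.+2 by rewrite /N; case: (size f) sf => [|[]].
(* The derivative divided by its leading coefficient [N + 1], the degree of [f]: it is monic, hence
   splits. *)
pose g := (pconst (N.+1%:R^-1))%:P * F^`().
have gN : g`_N = 1.
  have := monicP mF; rewrite lead_coefE sF sN => FN.
  by rewrite coefCM coef_deriv FN pconst_natr_inv.
have sg : (size g <= N.+1)%N.
  rewrite /g mul_polyC (leq_trans (size_scale_leq _ _)) // -ltnS -sN -sF.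
  exact/lt_size_deriv/monic_neq0.
have mg : g \is monic.
  have sgE : size g = N.+1.
    apply/eqP; rewrite eqn_leq sg ltnNge; apply/negP => /leq_sizeP/(_ N (leqnn N)).
    by rewrite gN => /eqP; rewrite oner_eq0.
  by rewrite monicE lead_coefE sgE gN.
have df0 : f^`() != 0.
  apply: contraTneq mg => df0; rewrite /g deriv_map df0 rmorph0 mulr0 monicE lead_coef0.
  by rewrite eq_sym oner_eq0.
have [gs Eg] := puiseux_split hchar mg.
(* A root [b] of [f_xi] at which [f_y] vanishes satisfies [F(b) = xi], so [xi] is the constant term
   of a critical value; these finitely many constants are excluded. *)
exists [seq F.[c] 0 | c <- gs] => xi nbad fxi.
have Efxi : map_poly (@tinv K) fxi = F - (pconst xi)%:P.
  by rewrite rmorphB /= map_polyC /= tinvC.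
have mfxi : map_poly (@tinv K) fxi \is monic.
  apply: monic_map; rewrite monicE lead_coefDl ?(monicP hmonic) // size_polyN.
  by rewrite (leq_ltn_trans (size_polyC_leq1 _)).
have [B EB] := puiseux_split hchar mfxi.
have nz b : b \in B -> (map_poly (@tinv K) f^`()).[b] != 0.
  move=> bB; apply: contraNneq nbad; rewrite -deriv_map -/F => dF0.
  have : root g b by rewrite /root hornerM dF0 mulr0.
  rewrite Eg root_prod_XsubC => bg; apply/mapP; exists b => //.
  have : root (map_poly (@tinv K) fxi) b by rewrite EB root_prod_XsubC.
  by rewrite Efxi /root !hornerE subr_eq0 => /eqP ->; rewrite pmonoE eqxx.
have [uB Ei] := inters_simple_roots EB (dfxi xi) df0 nz.
exists (nodes_of B); split.
- exact: undup_uniq.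
- by move=> s; rewrite (split_pirootP _ EB); apply: nodes_ofP.
rewrite Ei -tree_sum //; congr (- _); rewrite big_seq [RHS]big_seq.
apply: eq_bigr => s /nodes_ofP[wf _].
by have [_ -> _] := lead_split EB wf; rewrite (nroots_split EB wf).
Qed.
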